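(* Let $p$ be a prime number and let $K$ be a field of characteristic $p > 0$. Let $G$ be a subgroup of $K^\ast \times K^\ast$ such that $r := \dim_{\mathbb{Q}} (G \otimes_{\mathbb{Z}} \mathbb{Q})$ is finite, and let $a, b \in K^\ast$. Then the equation $$ax + by = 1 \quad \text{in } (x,y) \in G$$ has at most $31 \cdot 19^{r+1}$ solutions $(x,y)$, unless $(a,b)^n \in G$ for some integer $n \geq 1$ with $\gcd(n,p) = 1$.
   Context: The group $K^\ast \times K^\ast$ carries coordinatewise multiplication, so $(a,b)^n = (a^n, b^n)$. *)

(* Defs.v *)
From HB Require Import structures.
From mathcomp Require Import all_boot all_order all_algebra.
From mathcomp Require Import boolp classical_sets cardinality.

Set Implicit Arguments.
Unset Strict Implicit.
Unset Printing Implicit Defensive.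

Import GRing.Theory.
Local Open Scope ring_scope.
Local Open Scope quotient_scope.

(* K * K carries the product ring structure, whose unit group is K^* x K^*:
   1, * and ^+ are coordinatewise, and so is ^-1 on pairs of nonzero elements. *)
Record subgroup (K : fieldType) := Subgroup {
  subgroup_set : set (K * K);
  subgroup_neq0 : forall u, subgroup_set u -> u.1 != 0 /\ u.2 != 0;
  subgroup1 : subgroup_set 1;
  subgroupM : forall u v, subgroup_set u -> subgroup_set v ->
    subgroup_set (u * v);
  subgroupV : forall u, subgroup_set u -> subgroup_set u^-1
}.

(* The group G written additively, i.e. as a Z-module. *)
Definition subgroup_zmod (K : fieldType) (G : subgroup K) : Type :=
  {u : K * K | u \in subgroup_set G}.

Section SubgroupZmod.
Variables (K : fieldType) (G : subgroup K).
Implicit Types u v w : subgroup_zmod G.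

HB.instance Definition _ := Choice.on (subgroup_zmod G).

Let add1 : 1 \in subgroup_set G.
Proof. exact/mem_set/subgroup1. Qed.

Let addM u v : val u * val v \in subgroup_set G.
Proof. by apply/mem_set/subgroupM; apply/set_mem/valP. Qed.

Let addV u : (val u)^-1 \in subgroup_set G.
Proof. exact/mem_set/subgroupV/set_mem/valP. Qed.

Definition subgroup_zmod_zero : subgroup_zmod G := exist _ 1 add1.
Definition subgroup_zmod_add u v : subgroup_zmod G := exist _ (val u * val v) (addM u v).
Definition subgroup_zmod_opp u : subgroup_zmod G := exist _ (val u)^-1 (addV u).

Let addA : associative subgroup_zmod_add.
Proof. by move=> u v w; apply/val_inj; rewrite /= mulrA. Qed.

Let addC : commutative subgroup_zmod_add.
Proof. by move=> u v; apply/val_inj; rewrite /= mulrC. Qed.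

Let add0 : left_id subgroup_zmod_zero subgroup_zmod_add.
Proof. by move=> u; apply/val_inj; rewrite /= mul1r. Qed.

Let addN : left_inverse subgroup_zmod_zero subgroup_zmod_opp subgroup_zmod_add.
Proof.
move=> u; apply/val_inj => /=.
have [u1 u2] := subgroup_neq0 (set_mem (valP u)).
by apply: mulVr; apply/andP; rewrite !unitfE.
Qed.

HB.instance Definition _ :=
  GRing.isZmodule.Build (subgroup_zmod G) addA addC add0 addN.

End SubgroupZmod.

(* The tensor product over Z of two abelian groups: formal sums of pairs,
   represented by sequences, modulo the congruence generated by reordering of
   the summands and biadditivity.  Formal negatives are not needed, because
   (- a, b) is the opposite of (a, b) modulo this congruence. *)
Inductive tensor_eq (A B : zmodType) : seq (A * B) -> seq (A * B) -> Prop :=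
| tensor_eq_refl s : tensor_eq s s
| tensor_eq_sym s t : tensor_eq s t -> tensor_eq t s
| tensor_eq_trans s t u : tensor_eq s t -> tensor_eq t u -> tensor_eq s u
| tensor_eq_cat s s' t t' :
    tensor_eq s s' -> tensor_eq t t' -> tensor_eq (s ++ t) (s' ++ t')
| tensor_eq_perm s t : perm_eq s t -> tensor_eq s t
| tensor_eq_0l b : tensor_eq [:: (0, b)] [::]
| tensor_eq_0r a : tensor_eq [:: (a, 0)] [::]
| tensor_eq_Dl a a' b : tensor_eq [:: (a + a', b)] [:: (a, b); (a', b)]
| tensor_eq_Dr a b b' : tensor_eq [:: (a, b + b')] [:: (a, b); (a, b')].

Section Tensor.
Variables A B : zmodType.
Implicit Types (s t u : seq (A * B)).

Definition tensor_rel s t := `[< tensor_eq s t >].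

Let tensor_rel_refl : reflexive tensor_rel.
Proof. by move=> s; apply/asboolP/tensor_eq_refl. Qed.

Let tensor_rel_sym : symmetric tensor_rel.
Proof. by move=> s t; apply/asboolP/asboolP; apply: tensor_eq_sym. Qed.

Let tensor_rel_trans : transitive tensor_rel.
Proof.
by move=> t s u /asboolP st /asboolP tu; apply/asboolP/(tensor_eq_trans st tu).
Qed.

Canonical tensor_equiv :=
  EquivRel tensor_rel tensor_rel_refl tensor_rel_sym tensor_rel_trans.

Definition tensor : Type := {eq_quot tensor_rel}.

HB.instance Definition _ := Choice.on tensor.
HB.instance Definition _ := Quotient.on tensor.
Implicit Types x y z : tensor.

Definition tensor_class s : tensor := \pi_tensor s.

Definition pure_tensor (a : A) (b : B) : tensor := tensor_class [:: (a, b)].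

Lemma tensor_classP s t : tensor_class s = tensor_class t <-> tensor_eq s t.
Proof.
split=> [/eqmodP/asboolP //|st].
by apply/eqmodP/asboolP.
Qed.

Lemma tensor_reprP s : tensor_eq (repr (tensor_class s)) s.
Proof. by apply/tensor_classP; rewrite /tensor_class reprK. Qed.

Lemma tensorW (P : tensor -> Prop) : (forall s, P (tensor_class s)) ->
  forall x, P x.
Proof. by move=> Ps x; rewrite -[x]reprK; apply: Ps. Qed.

Definition tensor_add x y : tensor := tensor_class (repr x ++ repr y).
Definition tensor_opp x : tensor :=
  tensor_class [seq (- ab.1, ab.2) | ab <- repr x].

Lemma tensor_addE s t :
  tensor_add (tensor_class s) (tensor_class t) = tensor_class (s ++ t).
Proof. by apply/tensor_classP/tensor_eq_cat; apply: tensor_reprP. Qed.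

Let opp_eq s t : tensor_eq s t ->
  tensor_eq [seq (- ab.1, ab.2) | ab <- s] [seq (- ab.1, ab.2) | ab <- t].
Proof.
elim=> {s t} [s|s t _|s t u _ st _|s s' t t' _ ss _ tt|s t st|b|a|a a' b|a b b'].
- exact: tensor_eq_refl.
- exact: tensor_eq_sym.
- exact: tensor_eq_trans st.
- by rewrite !map_cat; apply: tensor_eq_cat.
- by apply/tensor_eq_perm/perm_map.
- by rewrite /= oppr0; apply: tensor_eq_0l.
- exact: tensor_eq_0r.
- by rewrite /= opprD; apply: tensor_eq_Dl.
- exact: tensor_eq_Dr.
Qed.

Lemma tensor_oppE s : tensor_opp (tensor_class s) =
  tensor_class [seq (- ab.1, ab.2) | ab <- s].
Proof. exact/tensor_classP/opp_eq/tensor_reprP. Qed.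

Let tensor_addA : associative tensor_add.
Proof.
elim/tensorW=> s; elim/tensorW=> t; elim/tensorW=> u.
by rewrite !tensor_addE catA.
Qed.

Let tensor_addC : commutative tensor_add.
Proof.
elim/tensorW=> s; elim/tensorW=> t.
by rewrite !tensor_addE; apply/tensor_classP/tensor_eq_perm/permEl/perm_catC.
Qed.

Let tensor_add0 : left_id (tensor_class [::]) tensor_add.
Proof. by elim/tensorW=> s; rewrite tensor_addE. Qed.

Let tensor_addN : left_inverse (tensor_class [::]) tensor_opp tensor_add.
Proof.
elim/tensorW=> s; rewrite tensor_oppE tensor_addE; apply/tensor_classP.
elim: s => [|[a b] s IHs] /=; first exact: tensor_eq_refl.
set s' := map _ s in IHs *.
apply: (@tensor_eq_trans _ _ _ ([:: (- a, b); (a, b)] ++ (s' ++ s))).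
  apply: tensor_eq_perm => /=; rewrite perm_cons.
  by rewrite -cat1s perm_catCA.
apply: (tensor_eq_trans (tensor_eq_cat (tensor_eq_refl _) IHs)); rewrite cats0.
apply: (tensor_eq_trans (tensor_eq_sym (tensor_eq_Dl _ _ _))).
by rewrite addNr; apply: tensor_eq_0l.
Qed.

HB.instance Definition _ := GRing.isZmodule.Build tensor
  tensor_addA tensor_addC tensor_add0 tensor_addN.

Lemma tensor_class_sum s :
  tensor_class s = \sum_(ab <- s) pure_tensor ab.1 ab.2.
Proof.
elim: s => [|[a b] s IHs]; first by rewrite big_nil.
by rewrite big_cons -IHs /pure_tensor [RHS]tensor_addE.
Qed.

Lemma pure_tensorDl a a' b :
  pure_tensor (a + a') b = pure_tensor a b + pure_tensor a' b.
Proof. by rewrite [RHS]tensor_addE; apply/tensor_classP/tensor_eq_Dl. Qed.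

Lemma pure_tensorDr a b b' :
  pure_tensor a (b + b') = pure_tensor a b + pure_tensor a b'.
Proof. by rewrite [RHS]tensor_addE; apply/tensor_classP/tensor_eq_Dr. Qed.

Lemma tensor_universal (C : zmodType) (f : A -> B -> C) :
  (forall a a' b, f (a + a') b = f a b + f a' b) ->
  (forall a b b', f a (b + b') = f a b + f a b') ->
  exists! g : tensor -> C,
    {morph g : x y / x + y} /\ forall a b, g (pure_tensor a b) = f a b.
Proof.
move=> fDl fDr; pose h s := \sum_(ab <- s) f ab.1 ab.2.
have f0l b : f 0 b = 0 by apply: (addrI (f 0 b)); rewrite -fDl !addr0.
have f0r a : f a 0 = 0 by apply: (addrI (f a 0)); rewrite -fDr !addr0.
have hP s t : tensor_eq s t -> h s = h t.
  rewrite /h.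
  elim=> {s t} [s|s t _ st|s t u _ st _ tu|s s' t t' _ ss _ tt|s t st|b|a|a a' b|a b b'] //=.
  - by rewrite st.
  - by rewrite !big_cat ss tt.
  - exact: perm_big.
  - by rewrite big_seq1 big_nil f0l.
  - by rewrite big_seq1 big_nil f0r.
  - by rewrite big_seq1 big_cons big_seq1 fDl.
  - by rewrite big_seq1 big_cons big_seq1 fDr.
have hE s : h (repr (tensor_class s)) = h s by apply/hP/tensor_reprP.
exists (fun x => h (repr x)); split; first split.
- elim/tensorW=> s; elim/tensorW=> t.
  by rewrite [_ + _]tensor_addE !hE /h big_cat.
- by move=> a b; rewrite hE /h big_seq1.
move=> g [gD gE]; apply/funext; elim/tensorW=> s; rewrite hE tensor_class_sum.
have g0 : g 0 = 0 by apply: (addrI (g 0)); rewrite -gD !addr0.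
by rewrite (big_morph g gD g0) /h; apply: eq_bigr => ab _.
Qed.

End Tensor.

Section TensorLmodule.
Variables (A : zmodType) (R : pzRingType) (B : lmodType R).
Implicit Types (s t u : seq (A * B)) (x y : tensor A B) (r : R).

Definition tensor_scale r x : tensor A B :=
  tensor_class [seq (ab.1, r *: ab.2) | ab <- repr x].

Let scale_eq r s t : tensor_eq s t ->
  tensor_eq [seq (ab.1, r *: ab.2) | ab <- s] [seq (ab.1, r *: ab.2) | ab <- t].
Proof.
elim=> {s t} [s|s t _|s t u _ st _|s s' t t' _ ss _ tt|s t st|b|a|a a' b|a b b'].
- exact: tensor_eq_refl.
- exact: tensor_eq_sym.
- exact: tensor_eq_trans st.
- by rewrite !map_cat; apply: tensor_eq_cat.
- by apply/tensor_eq_perm/perm_map.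
- exact: tensor_eq_0l.
- by rewrite /= scaler0; apply: tensor_eq_0r.
- exact: tensor_eq_Dl.
- by rewrite /= scalerDr; apply: tensor_eq_Dr.
Qed.

Lemma tensor_scaleE r s : tensor_scale r (tensor_class s) =
  tensor_class [seq (ab.1, r *: ab.2) | ab <- s].
Proof. exact/tensor_classP/scale_eq/tensor_reprP. Qed.

Let scaleA r r' x : tensor_scale r (tensor_scale r' x) = tensor_scale (r * r') x.
Proof.
elim/tensorW: x => s; rewrite !tensor_scaleE -map_comp; congr tensor_class.
by apply: eq_map => ab /=; rewrite scalerA.
Qed.

Let scale1 : left_id 1 tensor_scale.
Proof.
elim/tensorW=> s; rewrite tensor_scaleE; congr tensor_class.
by rewrite -[RHS]map_id; apply: eq_map => -[a b] /=; rewrite scale1r.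
Qed.

Let scaleDr : right_distributive tensor_scale +%R.
Proof.
move=> r; elim/tensorW=> s; elim/tensorW=> t.
by rewrite [_ + _]tensor_addE !tensor_scaleE [RHS]tensor_addE map_cat.
Qed.

Let scaleDl x : {morph tensor_scale^~ x : r r' / r + r'}.
Proof.
move=> r r'; elim/tensorW: x => s.
rewrite !tensor_scaleE !tensor_class_sum !big_map -big_split /=.
by apply: eq_bigr => ab _; rewrite scalerDl pure_tensorDr.
Qed.

HB.instance Definition _ := GRing.Zmodule_isLmodule.Build R (tensor A B)
  scaleA scale1 scaleDr scaleDl.

Lemma scale_pure_tensor r a (b : B) :
  r *: pure_tensor a b = pure_tensor a (r *: b).
Proof. exact: tensor_scaleE. Qed.

End TensorLmodule.

Definition has_dim (F : fieldType) (V : lmodType F) (r : nat) : Prop :=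
  exists e : 'I_r -> V,
    forall v, exists! c : {ffun 'I_r -> F}, v = \sum_(i < r) c i *: e i.

(* Main.v *)
Require Import Defs.
From HB Require Import structures.
From mathcomp Require Import all_boot all_order all_algebra.
From mathcomp Require Import ring zify.
From mathcomp Require Import mpoly.
From mathcomp Require Import boolp.

Set Implicit Arguments.
Unset Strict Implicit.
Unset Printing Implicit Defensive.

Import Order.TTheory GRing.Theory Num.Theory.
Local Open Scope ring_scope.

(** The solutions (X, Y) = (ax, by) of X + Y = 1 are pairwise not related by a power
    of Frobenius, because X' = X^q and Y' = Y^q with q = p^n > 1 would put (a, b)^(q-1)
    in G; for the same reason no X is fixed by a power of Frobenius.  In a finitely
    generated field we may thus replace them by distinct pairs (u, v) with u + v = 1,
    X = u^(p^k) and u not a p-th power, and there is a derivation D with D^p = 0 and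
    D u <> 0 for all these u.

    Let s be the dimension of the F_p-space spanned by the logarithmic derivatives
    (Du/u, Dv/v), and express them in a basis taken among them.  The pair with coordinates
    m in F_p^s is determined by its logarithmic derivatives L(m), M(m), which are linear
    in m, since u = M/(M-L); the identity Du = uL becomes the cubic equation
    M L' - M' L = L M (M - L) in m.  A tangent vector n at a solution yields w with
    Dw = L(n) = Dg/g for some g, and likewise for M(n); a logarithmic derivative being
    exact only if it vanishes, n = 0.  So the points m are nondegenerate zeros
    of polynomials of degree 3 in s variables, whence there are at most 4^s of them.
    The s basis elements are multiplicatively independent, and so are the corresponding
    (X, Y); dividing by one of them gives s - 1 independent elements of G, so
    s <= r + 1. *)

(** * Nondegenerate zeros of polynomial systems *)

Lemma linear_dependence (K : fieldType) (I J : finType) (g : I -> J -> K) :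
  (#|J| < #|I|)%N ->
  exists c : I -> K, (exists i, c i != 0) /\ forall j, \sum_i c i * g i j = 0.
Proof.
move=> ltJI.
pose A := \matrix_(i < #|I|, j < #|J|) g (enum_val i) (enum_val j).
have : ~~ row_free A.
  by rewrite /row_free neq_ltn (leq_ltn_trans (rank_leq_col A)).
rewrite -kermx_eq0 => /rowV0Pn[v /sub_kermxP vA v0].
exists (fun i => v 0 (enum_rank i)); split.
  have [i vi] : exists i, v 0 i != 0.
    apply/existsP; apply: contraNT v0; rewrite negb_exists => /forallP v0.
    by apply/eqP/rowP => i; rewrite mxE; apply/eqP/negPn/v0.
  by exists (enum_val i); rewrite enum_valK.
move=> j; have := congr1 (fun B : 'rV_ _ => B 0 (enum_rank j)) vA.
rewrite !mxE => vAj; rewrite -[RHS]vAj.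
rewrite (reindex (@enum_val I predT)) /=; last first.
  by apply: onW_bij; apply: enum_val_bij.
by apply: eq_bigr => i _; rewrite mxE enum_valK enum_rankK.
Qed.

Section LeadingTerm.
Variable R : comNzRingType.
Implicit Types (p q : {poly R}) (a b : R).

(** The term of lowest order at 0. The coefficient [a] may be zero, so the order is only bounded
    below by [n]. *)
Definition leading_term p n a := exists2 q, p = 'X^n * q & q.[0] = a.

Lemma leading_termC a : leading_term a%:P 0 a.
Proof. by exists a%:P; rewrite ?expr0 ?mul1r ?hornerC. Qed.

Lemma leading_termM p q n m a b : leading_term p n a -> leading_term q m b ->
  leading_term (p * q) (n + m) (a * b).
Proof.
move=> [p' -> <-] [q' -> <-]; exists (p' * q'); last by rewrite hornerM.
by rewrite exprD mulrACA.
Qed.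

Lemma leading_termX p n a k : leading_term p n a -> leading_term (p ^+ k) (n * k) (a ^+ k).
Proof.
move=> pn; elim: k => [|k IHk]; first by rewrite muln0 !expr0; apply: leading_termC.
by rewrite mulnS !exprS; apply: leading_termM.
Qed.

Lemma leading_term_prod (I : Type) (r : seq I) (F : I -> {poly R})
    (n : I -> nat) (a : I -> R) :
  (forall i, leading_term (F i) (n i) (a i)) ->
  leading_term (\prod_(i <- r) F i) (\sum_(i <- r) n i) (\prod_(i <- r) a i).
Proof.
move=> Fn; elim: r => [|i r IHr]; first by rewrite !big_nil; apply: leading_termC.
by rewrite !big_cons; apply: leading_termM.
Qed.

Lemma leading_term_coef p n a : leading_term p n a -> p`_n = a.
Proof. by move=> [q -> <-]; rewrite coefXnM ltnn subnn horner_coef0. Qed.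

Lemma leading_term_coef_lt p n a k : leading_term p n a -> (k < n)%N -> p`_k = 0.
Proof. by move=> [q -> _] ltkn; rewrite coefXnM ltkn. Qed.

Lemma leading_term1 p : p.[0] = 0 -> leading_term p 1 p^`().[0].
Proof.
move=> p0; have /factor_theorem[q ->] : root p 0 by apply/rootP.
exists q; first by rewrite subr0 expr1 mulrC.
by rewrite derivM hornerD !hornerM derivXsubC hornerXsubC subrr mulr0 add0r hornerC mulr1.
Qed.

End LeadingTerm.

Section Substitution.
Variables (K : fieldType) (s : nat) (z : 'I_s -> K) (Y : 'I_s -> {mpoly K[s]}).

(** Restriction to the line z + T Y, where T is the outer polynomial variable. The direction [Y]
    consists of polynomials, so the coefficients of powers of T are again polynomials in the s
    variables. *)
Definition line_subst : {mpoly K[s]} -> {poly {mpoly K[s]}} :=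
  locked (mmap (polyC \o @mpolyC s K) (fun i => (z i)%:MP%:P + 'X * (Y i)%:P)).

Lemma line_substC c : line_subst c%:MP = c%:MP%:P.
Proof. by rewrite /line_subst -lock; apply: mmapC. Qed.

Lemma line_substD p q : line_subst (p + q) = line_subst p + line_subst q.
Proof. by rewrite /line_subst -lock; apply: mmapD. Qed.

Lemma line_substM p q : line_subst (p * q) = line_subst p * line_subst q.
Proof. by rewrite /line_subst -lock; apply: (mmap_is_multiplicative _ _).1. Qed.

Lemma line_subst_lin (I : Type) (r : seq I) (c : I -> K) (F : I -> {mpoly K[s]}) :
  line_subst (\sum_(i <- r) c i *: F i) = \sum_(i <- r) (c i)%:MP%:P * line_subst (F i).
Proof.
rewrite (big_morph _ line_substD (_ : line_subst 0 = 0)); last first.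
  by rewrite -mpolyC0 line_substC.
by apply: eq_bigr => i _; rewrite -mul_mpolyC line_substM line_substC.
Qed.

Lemma line_subst_prod (I : Type) (r : seq I) (F : I -> {mpoly K[s]}) :
  line_subst (\prod_(i <- r) F i) = \prod_(i <- r) line_subst (F i).
Proof. by apply: (big_morph _ line_substM); rewrite -mpolyC1 line_substC. Qed.

Lemma line_substX p n : line_subst (p ^+ n) = line_subst p ^+ n.
Proof.
elim: n => [|n IHn]; first by rewrite !expr0 -mpolyC1 line_substC.
by rewrite !exprS line_substM IHn.
Qed.

Lemma line_substXU i : line_subst 'X_i = (z i)%:MP%:P + 'X * (Y i)%:P.
Proof. by rewrite /line_subst -lock mmapX mmap1U. Qed.

(** Both identities hold for constants and variables and are preserved by sums and, by the Leibniz
    rule, by products. *)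
Lemma line_subst_taylor p :
  (line_subst p).[0] = (p.@[z])%:MP /\
  (line_subst p)^`().[0] = \sum_i (p^`M(i).@[z]) *: Y i.
Proof.
pose P q := (line_subst q).[0] = (q.@[z])%:MP /\
  (line_subst q)^`().[0] = \sum_i (q^`M(i).@[z]) *: Y i.
have PC c : P c%:MP.
  rewrite /P line_substC hornerC derivC horner0 mevalC; split=> //.
  by rewrite big1 // => i _; rewrite mderivC meval0 scale0r.
have PD q r : P q -> P r -> P (q + r).
  move=> [q0 q1] [r0 r1]; rewrite /P line_substD derivD !hornerD q0 q1 r0 r1.
  rewrite mevalD mpolyCD; split=> //.
  by rewrite -big_split; apply: eq_bigr => i _; rewrite mderivD mevalD scalerDl.
have PM q r : P q -> P r -> P (q * r).
  move=> [q0 q1] [r0 r1]; rewrite /P line_substM derivM hornerD !hornerM q0 q1 r0 r1.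
  rewrite mevalM mpolyCM; split=> //.
  rewrite mulr_suml mulr_sumr -big_split /=; apply: eq_bigr => i _.
  by rewrite mderivM mevalD !mevalM -!mul_mpolyC mpolyCD !mpolyCM; ring.
have PX i : P 'X_i.
  rewrite /P line_substXU derivD derivC add0r derivM derivX mul1r derivC mulr0 addr0.
  rewrite !hornerE mevalXU; split=> //.
  rewrite (bigD1 i) //= big1 ?addr0 => [|j ji].
    by rewrite mderivX mnm1E eqxx scale1r -[X in (X - _)%MM]add0m addmK mpolyX0 meval1 scale1r.
  by rewrite mderivX mnm1E eq_sym (negPf ji) scale0r meval0 scale0r.
have P1 : P 1 by rewrite -mpolyC1; apply: PC.
have PXn q n : P q -> P (q ^+ n).
  by move=> Pq; elim: n => [|n IHn]; rewrite ?expr0 // exprS; apply: PM.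
have Pprod (I : Type) (r : seq I) (F : I -> {mpoly K[s]}) :
    (forall i, P (F i)) -> P (\prod_(i <- r) F i).
  by move=> PF; elim/big_ind: _.
elim/mpolyind: p => [|c m p _ _ Pp]; first by rewrite -mpolyC0; apply: PC.
apply: PD => //; rewrite -mul_mpolyC mpolyXE_id.
by apply: PM => //; apply: Pprod => i; apply: PXn.
Qed.

End Substitution.

Lemma msize_mul_le (K : fieldType) (s : nat) (p q : {mpoly K[s]}) a b :
  (msize p <= a.+1)%N -> (msize q <= b.+1)%N -> (msize (p * q) <= (a + b).+1)%N.
Proof.
have [->|p0] := eqVneq p 0; first by rewrite mul0r msize0.
have [->|q0] := eqVneq q 0; first by rewrite mulr0 msize0.
move=> pa qb; rewrite msizeM // -ltnS.
by case: (msize p) (msize q) pa qb => [|m] [|n] //=; rewrite ?addSn ?addnS ?ltnS; lia.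
Qed.

Lemma msize_prod_le (K : fieldType) (s : nat) (I : Type) (r : seq I) (P : pred I)
    (F : I -> {mpoly K[s]}) (n : I -> nat) :
  (forall i, P i -> (msize (F i) <= (n i).+1)%N) ->
  (msize (\prod_(i <- r | P i) F i) <= (\sum_(i <- r | P i) n i).+1)%N.
Proof.
move=> Fn; elim/big_rec2: _ => [|i p m Pi IH]; first by rewrite msize1.
by apply: msize_mul_le => //; apply: Fn.
Qed.

Section NondegenerateZeros.
Variables (K : fieldType) (s d N : nat).
Variables (f : 'I_s -> {mpoly K[s]}) (z : 'I_N -> 'I_s -> K).
Hypothesis size_f : forall i, (msize (f i) <= d.+1)%N.
Hypothesis z_inj : forall k l, z k =1 z l -> k = l.
Hypothesis f_z : forall k i, (f i).@[z k] = 0.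
Hypothesis f_z' : forall k, \matrix_(i, j) (f i)^`M(j).@[z k] \in unitmx.

Let jacobian k := \matrix_(i, j) (f i)^`M(j).@[z k].
(** The inverse Jacobian applied to the vector of variables: along this direction the linear part of
    [f i] at [z k] is exactly the variable ['X_i]. *)
Let Y k (i : 'I_s) : {mpoly K[s]} := \sum_j invmx (jacobian k) i j *: 'X_j.

Let f_leading_term k i : leading_term (line_subst (z k) (Y k) (f i)) 1 'X_i.
Proof.
have [f0 f1] := line_subst_taylor (z k) (Y k) (f i).
have -> : 'X_i = (line_subst (z k) (Y k) (f i))^`().[0].
  rewrite f1; under eq_bigr do rewrite /Y scaler_sumr.
  rewrite exchange_big (eq_bigr (fun j => (1%:M : 'M[K]_s) i j *: 'X_j)) /=.
    rewrite (bigD1 i) //= mxE eqxx scale1r big1 ?addr0 // => j ji.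
    by rewrite mxE eq_sym (negPf ji) scale0r.
  move=> j _; rewrite -(mulmxV (f_z' k)) mxE scaler_suml.
  by apply: eq_bigr => l _; rewrite scalerA /jacobian !mxE.
by apply: leading_term1; rewrite f0 f_z mpolyC0.
Qed.

(** A product of N - 1 polynomials of degree at most 1, one for each other zero, chosen in a
    coordinate where that zero differs from [z k]. *)
Let separating_polynomial k : exists h : {mpoly K[s]},
  [/\ (msize h <= N)%N, h.@[z k] != 0 & forall l, l != k -> h.@[z l] = 0].
Proof.
have sep l : exists g : {mpoly K[s]},
    [/\ (msize g <= 2)%N, g.@[z k] != 0 & l != k -> g.@[z l] = 0].
  have [->|lk] := eqVneq l k; first by exists 1; rewrite msize1 meval1 oner_eq0.
  have [i zi] : exists i, z k i != z l i.
    apply/existsP; apply: contraNT lk; rewrite negb_exists => /forallP zz.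
    by apply/eqP/z_inj => i; apply/esym/eqP/negPn/zz.
  exists ('X_i - (z l i)%:MP); rewrite !mevalB !mevalXU !mevalC subrr subr_eq0; split=> //.
  by apply: leq_trans (msizeD_le _ _) _; rewrite msizeN msizeC msizeX mdeg1 geq_max; case: (_ == _).
have [g gP] : exists g : 'I_N -> {mpoly K[s]}, forall l,
    [/\ (msize (g l) <= 2)%N, (g l).@[z k] != 0 & l != k -> (g l).@[z l] = 0].
  apply: (fin_all_exists (fun l => sep l)).
exists (\prod_(l | l != k) g l); split.
- apply: (@leq_trans (\sum_(l | l != k) 1).+1).
    by apply: msize_prod_le => l _; have [] := gP l.
  by rewrite sum1_card cardC1 card_ord (ltn_predK (ltn_ord k)).
- by rewrite rmorph_prod; apply/prodf_neq0 => l _; have [] := gP l.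
- move=> l lk; rewrite rmorph_prod (bigD1 l) //=.
  by have [_ _ ->] := gP l; rewrite // mul0r.
Qed.

Let B := (d.+1 * N)%N.

(** Euclidean division of every exponent by d + 1: the remainders have (d + 1)^s possible values,
    and the quotients have total degree at most B / (d + 1) = N. *)
Let card_bmultinom_mul :
  (#|{: 'X_{1.. s < B.+1}}| <= #|{: 'X_{1.. s < N.+1}}| * d.+1 ^ s)%N.
Proof.
have divP (m : 'X_{1.. s < B.+1}) :
    (mdeg [multinom (m i %/ d.+1)%N | i < s] < N.+1)%N.
  rewrite ltnS mdegE -(@leq_pmul2l d.+1) // big_distrr /=.
  apply: leq_trans (_ : mdeg m <= _)%N; last by have := bmdeg m; rewrite ltnS.
  by rewrite mdegE; apply: leq_sum => i _; rewrite mnmE mulnC leq_trunc_div.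
pose g (m : 'X_{1.. s < B.+1}) : 'X_{1.. s < N.+1} * {ffun 'I_s -> 'I_d.+1} :=
  (BMultinom (divP m), [ffun i => inord (m i %% d.+1)]).
rewrite -[X in (_ * X ^ _)%N]card_ord -[X in (_ * _ ^ X)%N]card_ord -card_ffun -card_prod.
apply: (@leq_card _ _ g) => m m' gm.
have /mnmP mm' := congr1 (fun x => bmnm x.1) gm; have /ffunP mm := congr1 snd gm.
apply/val_inj/mnmP => i /=; rewrite (divn_eq (m i) d.+1) (divn_eq (m' i) d.+1).
have := mm' i; rewrite !mnmE => ->; congr (_ + _)%N.
by have := congr1 (@nat_of_ord _) (mm i); rewrite !ffunE !inordK ?ltn_pmod.
Qed.

(* With [h k] vanishing at every zero but [z k], the products [f ^ e * h k] are linearly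
   independent: in a relation, the terms of least [|e|] have independent leading forms
   at [z k].  For [|e| <= N] their degree is at most [(d + 1) * N], so there are at most
   [(d + 1) ^ s] times as many monomials available as exponents [e]. *)
Theorem nondegenerate_zeros_bound : (N <= d.+1 ^ s)%N.
Proof.
rewrite leqNgt; apply/negP => ltN.
have [h hP] := fin_all_exists separating_polynomial.
pose g (ek : 'X_{1.. s < N.+1} * 'I_N) : {mpoly K[s]} :=
  (\prod_i f i ^+ ek.1 i) * h ek.2.
have size_g ek : (msize (g ek) <= B.+1)%N.
  have [hN _ _] := hP ek.2.
  have N0 : (0 < N)%N by apply: leq_trans (ltn_ord ek.2).
  rewrite /B mulSn addnC; apply: msize_mul_le; last by apply: leq_trans hN _.
  apply: (@leq_trans (\sum_i d * ek.1 i).+1).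
    apply: msize_prod_le => i _; elim: (ek.1 i) => [|n IHn]; first by rewrite expr0 msize1.
    by rewrite exprS mulnS; apply: msize_mul_le.
  by rewrite ltnS -big_distrr leq_mul2l -mdegE -ltnS bmdeg orbT.
have [|c [[[e k] cek] c0]] :=
  @linear_dependence K _ _ (fun ek (m : 'X_{1.. s < B.+1}) => (g ek)@_m).
  rewrite card_prod card_ord; apply: leq_ltn_trans card_bmultinom_mul _.
  by rewrite ltn_pmul2l //; apply/card_gt0P; exists bm0.
have {c0} rel : \sum_ek c ek *: g ek = 0.
  apply/mpolyP => m; rewrite mcoeff0 raddf_sum /=; under eq_bigr do rewrite mcoeffZ.
  case: (ltnP (mdeg m) B.+1) => mB; first exact: (c0 (BMultinom mB)).
  rewrite big1 // => ek _; rewrite memN_msupp_eq0 ?mulr0 //.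
  by apply: msize_mdeg_ge; apply: leq_trans mB.
have {e k cek} [e [k [cek emin]]] : exists e, exists k, c (e, k) != 0 /\
    forall e' k', (mdeg (bmnm e') < mdeg (bmnm e))%N -> c (e', k') = 0.
  pose P n := [exists ek, (mdeg (bmnm ek.1) == n) && (c ek != 0)].
  have exP : exists n, P n by exists (mdeg e); apply/existsP; exists (e, k); rewrite eqxx.
  case: (ex_minnP exP) => n /existsP[[e' k'] /= /andP[/eqP <- ce']] minn.
  exists e', k'; split=> // e'' k''; rewrite ltnNge; apply: contraNeq => c''.
  by apply: minn; apply/existsP; exists (e'', k''); rewrite eqxx.
have lead ek : leading_term (line_subst (z k) (Y k) (g ek)) (mdeg ek.1)
    ('X_[ek.1] * ((h ek.2).@[z k])%:MP).
  rewrite /g line_substM -[mdeg _]addn0; apply: leading_termM; last first.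
    exists (line_subst (z k) (Y k) (h ek.2)); first by rewrite expr0 mul1r.
    by have [-> _] := line_subst_taylor (z k) (Y k) (h ek.2).
  rewrite line_subst_prod mdegE mpolyXE_id; apply: leading_term_prod => i.
  by rewrite line_substX -[X in leading_term _ X]mul1n; apply: leading_termX; apply: f_leading_term.
(* Compare coefficients of T^|e|, then of the monomial e. Smaller |e'| are excluded by minimality
   and larger ones start at a higher order. When |e'| = |e|, the form is the monomial e' times
   [h k'] at [z k], which vanishes for k' <> k. *)
have := congr1 (fun p => (line_subst (z k) (Y k) p)`_(mdeg e)) rel.
rewrite line_subst_lin coef_sum -mpolyC0 line_substC coefC if_same.
move=> /(congr1 (mcoeff e)); rewrite mpolyC0 mcoeff0 raddf_sum /= (bigD1 (e, k)) //=.
rewrite coefCM (leading_term_coef (lead (e, k))) /= mcoeffCM.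
rewrite [_ * _%:MP]mulrC mcoeffCM mcoeffX eqxx mulr1 big1 ?addr0 => [/eqP|].
  by rewrite mulf_eq0 (negPf cek) /=; have [_ /negPf-> _] := hP k.
move=> [e' k'] ne; rewrite coefCM mcoeffCM.
have [lt|gt|eq_e] := ltngtP (mdeg (bmnm e')) (mdeg (bmnm e)).
- by rewrite emin // mul0r.
- by rewrite (leading_term_coef_lt (lead (e', k'))) ?mcoeff0 ?mulr0.
rewrite -eq_e (leading_term_coef (lead (e', k'))) /= [_ * _%:MP]mulrC mcoeffCM mcoeffX.
have [k'k|k'k] := eqVneq k' k; last first.
  by have [_ _ ->] := hP k'; rewrite ?mul0r ?mulr0 // eq_sym.
case: eqP => [e'e|]; last by rewrite !mulr0.
by case/eqP: ne; congr (_, _) => //; apply/val_inj.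
Qed.

End NondegenerateZeros.

(** * Frobenius powers and derivations of exponent p *)

Section FrobeniusPower.
Variables (p : nat) (K : fieldType) (hK : p \in [pchar K]).

(** The characteristic hypothesis is an argument so that ring morphism instances can be attached to
    the map. *)
Definition frobenius of p \in [pchar K] := fun (i : nat) (x : K) => x ^+ (p ^ i).

Lemma frobenius_zmod i : zmod_morphism (frobenius hK i).
Proof.
move=> x y; rewrite /frobenius; elim: i x y => [|i IHi] x y; first by rewrite !expr1.
by rewrite expnSr !exprM IHi -!(pFrobenius_autE hK) rmorphB.
Qed.

Lemma frobenius_monoid i : monoid_morphism (frobenius hK i).
Proof. by split=> [|x y]; rewrite /frobenius ?expr1n ?exprMn. Qed.

HB.instance Definition _ i :=
  GRing.isZmodMorphism.Build K K (frobenius hK i) (frobenius_zmod i).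
HB.instance Definition _ i :=
  GRing.isMonoidMorphism.Build K K (frobenius hK i) (frobenius_monoid i).

Lemma frobenius_intr i (n : int) : frobenius hK i n%:~R = n%:~R.
Proof. exact: rmorph_int. Qed.

End FrobeniusPower.

Section Moore.
Variables (p : nat) (K : fieldType) (hK : p \in [pchar K]) (s : nat) (v : 'I_s -> K).

(* A relation between the rows is an additive polynomial of degree at most [p ^ (s - 1)]
   vanishing at the [p ^ s] combinations of the [v j] with coefficients in F_p. *)
Lemma moore_matrix_unit :
  (forall n : 'I_s -> int, \sum_j (n j)%:~R * v j = 0 -> forall j, (p %| `|n j|)%N) ->
  \matrix_(i < s, j < s) v j ^+ (p ^ i) \in unitmx.
Proof.
move=> v_free; have p_pr := pcharf_prime hK.
rewrite -row_free_unit -kermx_eq0; apply/contraT => /rowV0Pn[c /sub_kermxP cM c0].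
pose P : {poly K} := \sum_(i < s) c 0 i *: 'X^(p ^ i).
have PE x : P.[x] = \sum_(i < s) c 0 i * frobenius hK i x.
  by rewrite horner_sum; apply: eq_bigr => i _; rewrite hornerZ hornerXn.
have P0 : P != 0.
  apply: contraNneq c0 => P0; apply/eqP/rowP => i.
  rewrite mxE -(coef0 K (p ^ i)) -P0 coef_sum (bigD1 i) //= big1 ?addr0 => [|j ji].
    by rewrite coefZ coefXn eqxx mulr1.
  rewrite coefZ coefXn eqn_exp2l ?prime_gt1 // (inj_eq val_inj) eq_sym (negPf ji).
  by rewrite mulr0.
pose g (n : {ffun 'I_s -> 'I_p}) := \sum_j (n j)%:R * v j.
have g_inj : injective g.
  move=> n m /eqP; rewrite -subr_eq0 -sumrB => /eqP gnm; apply/ffunP => j.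
  have nm : \sum_j ((n j)%:Z - (m j)%:Z)%:~R * v j = 0.
    by rewrite -[RHS]gnm; apply: eq_bigr => l _; rewrite intrB mulrBl.
  have := v_free _ nm j; have := ltn_ord (n j); have := ltn_ord (m j).
  move=> ltm ltn dvd_nm; apply/val_inj => /=.
  suff : ~ (0 < `|(n j)%:Z - (m j)%:Z|)%N by lia.
  by move=> /dvdn_leq/(_ dvd_nm); lia.
have size_P : (size P <= (p ^ s.-1).+1)%N.
  apply: leq_trans (size_sum _ _ _) _; apply/bigmax_leqP => i _.
  apply: leq_trans (size_scale_leq _ _) _; rewrite size_polyXn ltnS leq_exp2l ?prime_gt1 //.
  by have := ltn_ord i; lia.
have : (size (codom g) < size P)%N.
  apply: max_poly_roots => //; last by rewrite map_inj_uniq ?enum_uniq.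
  apply/allP => _ /codomP[n ->]; apply/rootP; rewrite PE.
  under eq_bigr do rewrite raddf_sum mulr_sumr.
  rewrite exchange_big big1 // => j _ /=.
  have := congr1 (fun B : 'rV_s => B 0 j) cM; rewrite !mxE => cMj.
  transitivity ((n j)%:R * (0 : K)); last by rewrite mulr0.
  rewrite -[X in _ = _ * X]cMj mulr_sumr; apply: eq_bigr => i _.
  by rewrite rmorphM rmorph_nat mxE mulrCA.
rewrite size_codom card_ffun !card_ord => /leq_trans/(_ size_P).
rewrite ltnS leq_exp2l ?prime_gt1 //.
(* For s = 0 the truncated exponent [s.-1] makes the count uninformative, but then [P] is an empty
   sum, against [P0]. *)
case: (posnP s) => [s0|s_gt0]; last by rewrite -{1}(prednK s_gt0) ltnn.
move: P0; rewrite /P big1 ?eqxx // => i _; have := ltn_ord i.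
by rewrite {2}s0 ltn0.
Qed.

End Moore.

(** * Derivations with D^p = 0 and their logarithmic derivatives *)

Section Derivation.
Variables (p : nat) (K : fieldType) (hK : p \in [pchar K]) (D : {additive K -> K}).
Hypothesis DM : forall x y, D (x * y) = D x * y + x * D y.

Lemma derivation_leibniz k x y : iter k D (x * y) =
  \sum_(i < k.+1) (iter (k - i) D x * iter i D y) *+ 'C(k, i).
Proof.
elim: k => [|k IHk]; first by rewrite big_ord1 /= bin0.
rewrite iterS IHk raddf_sum /=.
transitivity (\sum_(i < k.+1) (iter (k.+1 - i) D x * iter i D y) *+ 'C(k, i) +
              \sum_(i < k.+1) (iter (k - i) D x * iter i.+1 D y) *+ 'C(k, i)).
  rewrite -big_split /=; apply: eq_bigr => i _.
  by rewrite raddfMn /= DM mulrnDl subSn // -ltnS.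
rewrite [in RHS]big_ord_recl [X in X + _]big_ord_recl /= !bin0 -addrA; congr (_ + _).
rewrite [X in X + _](_ : _ = \sum_(i < k.+1) (iter (k - i) D x * iter i.+1 D y) *+ 'C(k, i.+1)).
  by rewrite -big_split /=; apply: eq_bigr => i _; rewrite /bump add1n subSS binS mulrnDr.
rewrite big_ord_recr /= bin_small // mulr0n addr0.
by apply: eq_bigr => i _; rewrite /bump add1n subSS.
Qed.

Hypothesis DpE : forall x, iter p D x = 0.

Lemma derivation1 : D 1 = 0.
Proof. by apply: (addrI (D 1)); rewrite addr0 -{3}[1]mulr1 DM mulr1 mul1r. Qed.

(* If [g] were [exp w], then [g * exp (- w)] would be constant; truncating the
   exponential in characteristic p leaves an error term of top degree p - 1,
   which is not the derivative of a polynomial. *)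
Lemma log_derivative_not_exact g w : g != 0 -> D g = g * D w -> D w = 0.
Proof.
move=> g0 Dg; have p_pr := pcharf_prime hK; have p_gt0 := prime_gt0 p_pr.
have fact_neq0 k : (k < p)%N -> k`!%:R != 0 :> K.
  elim: k => [|k IHk] ltkp; first by rewrite oner_eq0.
  rewrite factS natrM mulf_neq0 ?IHk ?(ltnW ltkp) // -(dvdn_pcharf hK).
  by apply: contraL ltkp => /dvdn_leq; rewrite -leqNgt; apply.
(* Taylor coefficients: below order p, sending x to the sum of [t k x] T^k respects products and
   turns [D] into d/dT. *)
pose t k x := iter k D x / k`!%:R.
have tS k x : (k < p)%N -> t k.+1 x *+ k.+1 = t k (D x).
  rewrite leq_eqVlt /t -iterSr => /orP[/eqP kp|ltkp].
    by rewrite kp DpE !mul0r mul0rn.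
  have Sk0 : k.+1%:R != 0 :> K by have := fact_neq0 _ ltkp; rewrite factS natrM mulf_eq0; case/norP.
  rewrite factS natrM -mulr_natr -mulrA; congr (_ * _).
  by rewrite invfM mulrAC mulVf // mul1r.
pose G := \poly_(i < p) t i g.
(* The constant term is dropped so that T divides [W] and (-W)^(p-1) starts at order p - 1. *)
pose W := \poly_(i < p) (if i == 0%N then 0 else t i w).
have derivG k : (k < p)%N -> G^`()`_k = t k (D g).
  move=> ltkp; rewrite coef_deriv coef_poly -tS //; case: ltnP => // lepk.
  have -> : k.+1 = p by apply/eqP; rewrite eqn_leq ltkp.
  by rewrite /t DpE mul0r.
have derivW k : (k < p)%N -> W^`()`_k = t k (D w).
  move=> ltkp; rewrite coef_deriv coef_poly -tS //; case: ltnP => // lepk.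
  have -> : k.+1 = p by apply/eqP; rewrite eqn_leq ltkp.
  by rewrite /t DpE mul0r.
have tM k : (k < p)%N -> t k (g * D w) = (G * W^`())`_k.
  move=> ltkp; rewrite coefMr /t derivation_leibniz mulr_suml.
  apply: eq_bigr => -[i /= leik] _; rewrite ltnS in leik.
  rewrite derivW ?(leq_ltn_trans leik) // coef_poly (leq_ltn_trans (leq_subr _ _)) //.
  rewrite /t -mulr_natr -(bin_fact leik) !natrM.
  have := fact_neq0 _ ltkp; rewrite -(bin_fact leik) !natrM !mulf_eq0.
  case/norP=> c0 /norP[i0 ki0]; field; exact/and3P.
pose A := G^`() - G * W^`().
have A0 k : (k < p)%N -> A`_k = 0.
  by move=> ltkp; rewrite coefB derivG // Dg tM // subrr.
pose e := \poly_(i < p) (i`!%:R^-1 : K).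
have derive : e^`() = e - (p.-1)`!%:R^-1 *: 'X^(p.-1).
  apply/polyP => k; rewrite coefB coefZ coefXn coef_deriv !coef_poly.
  have [ltkp|gtkp|->] := ltngtP k p.-1; last 1 first.
  - by rewrite prednK // ltnn leqnn mul0rn mulr1 subrr.
  - rewrite mulr0 subr0 -{1}(prednK p_gt0) ltnS ltkp (leq_trans ltkp (leq_pred _)).
    have ltk1 : (k.+1 < p)%N by rewrite -(prednK p_gt0) ltnS.
    rewrite factS natrM -[LHS]mulr_natr; have := fact_neq0 _ ltk1.
    by rewrite factS natrM mulf_eq0 invfM => /norP[? ?]; rewrite mulrAC mulVf ?mul1r.
  have lepk : (p <= k)%N by rewrite -(prednK p_gt0).
  by rewrite mulr0 subr0 !ltnNge lepk (leqW lepk) mul0rn.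
pose E := e \Po - W.
pose H := G * E.
have H'E : H^`() = A * E + (p.-1)`!%:R^-1%:P * (G * W^`() * (- W) ^+ p.-1).
  rewrite /H derivM deriv_comp derive derivN comp_polyB comp_polyZ comp_Xn_poly.
  by rewrite /A -/E -mul_polyC; ring.
(* A derivative has no term of degree p - 1 in characteristic p. Computed from [H'E], this
   coefficient is g (D w) (- D w)^(p-1) / (p-1)!, which forces D w = 0. *)
have : H^`()`_(p.-1) = 0 by rewrite coef_deriv prednK // mulrn_pchar.
have [V WE] : exists V, W = 'X * V.
  have /factor_theorem[q ->] : root W 0.
    by apply/rootP; rewrite horner_coef0 coef_poly p_gt0 eqxx.
  by exists q; rewrite subr0 mulrC.
have V0 : V`_0 = D w.
  have := derivW 0 p_gt0; rewrite WE derivM derivX mul1r coefD coefXM eqxx addr0 => ->.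
  by rewrite /t divr1.
rewrite H'E coefD [X in X + _](_ : _ = 0); last first.
  by rewrite coefM big1 // => -[i /= leip] _; rewrite A0 ?mul0r // -(prednK p_gt0).
rewrite add0r coefCM WE -mulrN exprMn mulrCA coefXnM ltnn subnn -WE.
rewrite -horner_coef0 !hornerM horner_exp hornerN !horner_coef0 V0 derivW //.
rewrite [G`_0]coef_poly p_gt0 /t !divr1 => /eqP; rewrite mulf_eq0 invr_eq0 (negPf (fact_neq0 _ _)).
  rewrite !mulf_eq0 (negPf g0) /= expf_eq0 oppr_eq0 andbC.
  by case/orP=> [/eqP//|/andP[/eqP]].
by rewrite ltn_predL.
Qed.

End Derivation.

(** A group killed by p is an F_p-space. Integers, with divisibility by p in place of vanishing,
    serve as its scalars so that they can later be used as exponents. The basis is a maximal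
    independent subfamily. *)
Lemma extract_basis_mod (p : nat) (V : zmodType) (N : nat) (t : 'I_N -> V) :
  prime p -> (forall x : V, x *+ p = 0) ->
  exists (s : nat) (J : 'I_s -> 'I_N),
    (forall n : 'I_s -> int, \sum_j t (J j) *~ n j = 0 -> forall j, (p %| `|n j|)%N) /\
    (forall i, exists m : 'I_s -> int, t i = \sum_j t (J j) *~ m j).
Proof.
move=> p_pr Vp.
pose indep (S : {set 'I_N}) := `[< forall n : 'I_N -> int,
  \sum_(j in S) t j *~ n j = 0 -> forall j, j \in S -> (p %| `|n j|)%N >].
have Vpz (x : V) (n : int) : (p %| `|n|)%N -> x *~ n = 0.
  rewrite -[p]/(`|p%:Z|)%N -[(_ %| _)%N]/(p%:Z %| n)%Z => /dvdzP[m ->].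
  by rewrite mulrC mulrzA -pmulrn Vp mul0rz.
have indep0 : indep set0 by apply/asboolP => n _ j; rewrite inE.
have [S /maxsetP[/asboolP S_free S_max] _] := maxset_exists indep0.
have S_span i : exists m : 'I_N -> int, t i = \sum_(j in S) t j *~ m j.
  have [iS|iS] := boolP (i \in S).
    exists (fun j => (j == i)%:Z); rewrite (bigD1 i) //= eqxx mulr1z big1 ?addr0 //.
    by move=> j /andP[_ /negPf->]; rewrite mulr0z.
  have /asboolPn : ~~ indep (i |: S).
    apply/negP => /S_max/(_ (subsetUr _ _)) eS; by rewrite -eS setU11 in iS.
  move=> /existsNP[n /not_implyP[]]; rewrite big_setU1 //= => nS.
  move=> /existsNP[j /not_implyP[jS /negP pj]].
  (* If p divided [n i], the term at i would vanish and the relation would live in the independent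
     set [S]. Bezout then inverts [n i] modulo p. *)
  have pi : coprime `|n i| p.
    rewrite coprime_sym prime_coprime //; apply/negP => pi; move: nS.
    rewrite Vpz // add0r => /S_free nS; case/setU1P: jS => [ji|/nS]; last exact/negP.
    by rewrite ji pi in pj.
  have /coprimezP[[a b] /= ab] : coprimez (n i) p by [].
  exists (fun j => - (n j * a)); rewrite -[LHS]mulr1z -ab mulrzDr (mulrC a) (mulrC b).
  rewrite !mulrzA -[t i *~ p]pmulrn Vp mul0rz addr0.
  have -> : t i *~ n i = - \sum_(j in S) t j *~ n j by apply/eqP; rewrite -addr_eq0 nS.
  rewrite mulNrz mulrz_suml -sumrN; apply: eq_bigr => l _.
  by rewrite mulrNz mulrzA.
exists #|S|, (fun j => enum_val j); split.
  move=> n nS j.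
  pose n' i := if [pick j : 'I_#|S| | enum_val j == i] is Some j then n j else 0.
  have n'E l : n' (enum_val l) = n l.
    rewrite /n'; case: pickP => [l' /eqP/enum_val_inj->//|/(_ l)]; by rewrite eqxx.
  rewrite -n'E; apply: S_free (enum_valP j); rewrite -[RHS]nS big_enum_val /=.
  by apply: eq_bigr => l _; rewrite n'E.
move=> i; have [m ->] := S_span i; exists (fun j => m (enum_val j)).
by rewrite big_enum_val.
Qed.

(** * Solutions with nonzero derivative *)

Section LogDerivative.
Variables (K : fieldType) (D : {additive K -> K}).
Hypothesis DM : forall x y, D (x * y) = D x * y + x * D y.

Let D1 : D 1 = 0.
Proof. exact: derivation1. Qed.

Lemma derivation_int (n : int) : D n%:~R = 0.
Proof. by rewrite raddfMz /= D1 mul0rz. Qed.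

Lemma derivationZ (n : int) x : D (n%:~R * x) = n%:~R * D x.
Proof. by rewrite DM derivation_int mul0r add0r. Qed.

Lemma derivation_div x y : y != 0 -> D (x / y) = (D x * y - x * D y) / y ^+ 2.
Proof.
move=> y0; have : D (x / y * y) = D x by rewrite divfK.
rewrite DM => Dx; have -> : D (x / y) = (D x - x / y * D y) / y by rewrite -Dx addrK mulfK.
by field.
Qed.

Lemma derivation_inv x : x != 0 -> D x^-1 = - (x^-1 * (D x / x)).
Proof.
move=> x0; rewrite -[x^-1]mul1r derivation_div // D1; field; exact: x0.
Qed.

Lemma derivationX x (n : int) : x != 0 -> D (x ^ n) = x ^ n * (n%:~R * (D x / x)).
Proof.
move=> x0.
have DXn m : D (x ^+ m) = x ^+ m * (m%:R * (D x / x)).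
  elim: m => [|m IHm]; first by rewrite expr0 D1 mul0r mulr0.
  by rewrite exprS DM IHm mulrSr; field.
case: n => n; first exact: DXn.
rewrite NegzE -exprnN derivation_inv ?expf_neq0 // DXn intrN; field.
by rewrite x0 expf_neq0.
Qed.

Lemma derivation_monomial (I : Type) (r : seq I) (x : I -> K) (n : I -> int) :
  (forall i, x i != 0) ->
  D (\prod_(i <- r) x i ^ n i) =
  (\prod_(i <- r) x i ^ n i) * \sum_(i <- r) (n i)%:~R * (D (x i) / x i).
Proof.
move=> x0; elim: r => [|i r IHr]; first by rewrite !big_nil D1 mulr0.
by rewrite !big_cons DM IHr derivationX //; ring.
Qed.

End LogDerivative.

(* For a solution of [u + v = 1] with logarithmic derivatives [L] and [M], one has
   [u = M / (M - L)], and [cubic_form] is what remains of the identity [D u = u * L];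
   the last two arguments stand for [D L] and [D M]. *)
Definition cubic_form (R : comNzRingType) (L M L' M' : R) :=
  M * L' - M' * L - L * M * (M - L).

(** The differential of [cubic_form] at the first four arguments, in the direction of the last
    four. *)
Definition cubic_form_diff (R : comNzRingType) (L M L' M' l m l' m' : R) :=
  m * L' + M * l' - m' * L - M' * l
  - (l * M * (M - L) + L * m * (M - L) + L * M * (m - l)).

Lemma cubic_form_diff_sum (R : comNzRingType) (L M L' M' : R) (I : Type) (r : seq I)
    (n l m l' m' : I -> R) :
  \sum_(i <- r) n i * cubic_form_diff L M L' M' (l i) (m i) (l' i) (m' i) =
  cubic_form_diff L M L' M' (\sum_(i <- r) n i * l i) (\sum_(i <- r) n i * m i)
    (\sum_(i <- r) n i * l' i) (\sum_(i <- r) n i * m' i).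
Proof.
rewrite /cubic_form_diff; elim: r => [|i r IHr]; first by rewrite !big_nil; ring.
by rewrite !big_cons IHr; ring.
Qed.

Section LinearForms.
Variables (K : fieldType) (s : nat).

Definition linear_mpoly (c : 'I_s -> K) : {mpoly K[s]} := \sum_j c j *: 'X_j.

Lemma linear_mpoly_eval c z : (linear_mpoly c).@[z] = \sum_j c j * z j.
Proof. by rewrite raddf_sum; apply: eq_bigr => j _; rewrite /= mevalZ mevalXU. Qed.

Lemma linear_mpoly_deriv c j : (linear_mpoly c)^`M(j) = (c j)%:MP.
Proof.
rewrite raddf_sum (bigD1 j) //= big1 ?addr0 => [|l lj].
  by rewrite mderivZ mderivX mnm1E eqxx scale1r -[X in (X - _)%MM]add0m addmK mpolyX0
    -mul_mpolyC mulr1.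
by rewrite mderivZ mderivX mnm1E (negPf lj) scale0r scaler0.
Qed.

Lemma linear_mpoly_size c : (msize (linear_mpoly c) <= 2)%N.
Proof.
apply: leq_trans (msize_sum _ _ _) _; apply/bigmax_leqP => j _.
by apply: leq_trans (msizeZ_le _ _) _; rewrite msizeX mdeg1.
Qed.

Definition cubic_mpoly (L M L' M' : 'I_s -> K) : {mpoly K[s]} :=
  cubic_form (linear_mpoly L) (linear_mpoly M) (linear_mpoly L') (linear_mpoly M').

Lemma cubic_mpoly_size L M L' M' : (msize (cubic_mpoly L M L' M') <= 4)%N.
Proof.
have sizeB (q r : {mpoly K[s]}) : (msize q <= 4)%N -> (msize r <= 4)%N -> (msize (q - r) <= 4)%N.
  by move=> q4 r4; apply: leq_trans (msizeD_le _ _) _; rewrite msizeN geq_max q4.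
have size2 c c' : (msize (linear_mpoly c * linear_mpoly c') <= 3)%N.
  by apply: (@msize_mul_le _ _ _ _ 1 1); apply: linear_mpoly_size.
apply: (sizeB); first by apply: (sizeB); apply: leq_trans (size2 _ _) _.
apply: (@msize_mul_le _ _ _ _ 2 1) => //.
by apply: leq_trans (msizeD_le _ _) _; rewrite msizeN geq_max !linear_mpoly_size.
Qed.

Lemma cubic_mpoly_eval L M L' M' z : (cubic_mpoly L M L' M').@[z] =
  cubic_form (\sum_j L j * z j) (\sum_j M j * z j) (\sum_j L' j * z j) (\sum_j M' j * z j).
Proof.
by rewrite /cubic_mpoly /cubic_form !(mevalB, mevalM) !linear_mpoly_eval.
Qed.

Lemma cubic_mpoly_deriv_eval L M L' M' z i : (cubic_mpoly L M L' M')^`M(i).@[z] =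
  cubic_form_diff (\sum_j L j * z j) (\sum_j M j * z j) (\sum_j L' j * z j) (\sum_j M' j * z j)
    (L i) (M i) (L' i) (M' i).
Proof.
rewrite /cubic_mpoly /cubic_form !(mderivB, mderivM) !linear_mpoly_deriv.
rewrite !(mevalB, mevalD, mevalM, mevalC) !linear_mpoly_eval /cubic_form_diff; ring.
Qed.

End LinearForms.

(** * From the cubic equation to the bound 4^s *)

Section Rank.
Variables (p : nat) (K : fieldType) (hK : p \in [pchar K]) (D : {additive K -> K}).
Hypothesis DM : forall x y, D (x * y) = D x * y + x * D y.
Hypothesis DpE : forall x, iter p D x = 0.
Variables (N : nat) (u v : 'I_N -> K).
Hypothesis uv1 : forall i, u i + v i = 1.
Hypothesis Du0 : forall i, D (u i) != 0.
Hypothesis u_inj : injective u.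

Let lam i := D (u i) / u i.
Let mu i := D (v i) / v i.

Let u0 i : u i != 0.
Proof. by apply: contraNneq (Du0 i) => ->; rewrite raddf0. Qed.

Let Dv i : D (v i) = - D (u i).
Proof. by apply/eqP; rewrite -addr_eq0 addrC -raddfD uv1 derivation1. Qed.

Let v0 i : v i != 0.
Proof. by apply: contraNneq (Du0 i) => vi; rewrite -[D _]opprK -Dv vi raddf0 oppr0. Qed.

Let vE i : v i = 1 - u i.
Proof. by rewrite -(uv1 i) [u i + _]addrC addrK. Qed.

Let lam0 i : lam i != 0.
Proof. by rewrite mulf_neq0 ?invr_eq0. Qed.

Let mu0 i : mu i != 0.
Proof. by rewrite mulf_neq0 ?invr_eq0 // Dv oppr_eq0. Qed.

Let mulam i : mu i - lam i = - (D (u i) / (u i * v i)).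
Proof.
have -> : mu i - lam i = - (D (u i) * (u i + v i) / (u i * v i)).
  by rewrite /mu /lam Dv; field; rewrite u0 v0.
by rewrite uv1 mulr1.
Qed.

Let mulam0 i : mu i - lam i != 0.
Proof. by rewrite mulam oppr_eq0 !mulf_neq0 ?invr_eq0 // mulf_neq0. Qed.

Let uE i : u i = mu i / (mu i - lam i).
Proof.
rewrite mulam /mu Dv; field.
by apply/and3P; split; rewrite ?oppr_eq0 ?u0 ?v0 ?Du0.
Qed.

Let cubic0 i : cubic_form (lam i) (mu i) (D (lam i)) (D (mu i)) = 0.
Proof.
have : D (mu i / (mu i - lam i)) = mu i / (mu i - lam i) * lam i.
  by rewrite -uE /lam mulrC divfK.
rewrite derivation_div // raddfB /= => e.
have : (D (mu i) * (mu i - lam i) - mu i * (D (mu i) - D (lam i))) =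
   mu i * lam i * (mu i - lam i).
  move/(congr1 (fun x => x * (mu i - lam i) ^+ 2)): e.
  by rewrite divfK ?expf_neq0 // => ->; field.
move/eqP; rewrite -subr_eq0 => /eqP e'; rewrite -[RHS]e' /cubic_form; ring.
Qed.

(** Varying D(log u) = L along a tangent vector gives D w = l, where w is the variation of log u. As
    l is also the logarithmic derivative of a monomial in the u's, [log_derivative_not_exact] makes
    it vanish. The same works for v and m. *)
Lemma log_form_free (s : nat) (J : 'I_s -> 'I_N) (n : 'I_s -> int) k :
  let l := \sum_j (n j)%:~R * lam (J j) in
  let m := \sum_j (n j)%:~R * mu (J j) in
  cubic_form_diff (lam k) (mu k) (D (lam k)) (D (mu k)) l m (D l) (D m) = 0 ->
  l = 0 /\ m = 0.
Proof.
move=> l m; rewrite /cubic_form_diff => dF; have := cubic0 k; rewrite /cubic_form => F.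
move: dF F (lam0 k) (mu0 k) (mulam0 k); move: (lam k) (mu k) => L M dF F L0 M0 ML0.
have exact x y : (forall i, x i != 0) -> y = \sum_j (n j)%:~R * (D (x (J j)) / x (J j)) ->
    forall q, D q = y -> y = 0.
  move=> x0 yE q Dq; rewrite -Dq.
  apply: (log_derivative_not_exact hK DM DpE (g := \prod_j x (J j) ^ n j)).
    by apply/prodf_neq0 => j _; rewrite expfz_neq0.
  by rewrite derivation_monomial // -yE Dq.
split.
(* The witness is m/M - (m - l)/(M - L), the variation of log u for u = M/(M - L). *)
- apply: (exact u l u0 erefl ((M * l - L * m) / (M * (M - L)))).
  rewrite derivation_div ?mulf_neq0 // (raddfB D) !DM !(raddfB D).
  apply: (mulIf (x := (M * (M - L)) ^+ 2)); first by rewrite expf_neq0 ?mulf_neq0.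
  rewrite divfK; last by rewrite expf_neq0 ?mulf_neq0.
  apply/eqP; rewrite -subr_eq0; apply/eqP.
  transitivity ((M * (M - L)) * (m * D L + M * D l - D m * L - D M * l
      - (l * M * (M - L) + L * m * (M - L) + L * M * (m - l)))
    + (M * D L - D M * L - L * M * (M - L)) * (M * l - 2%:R * M * m + L * m)).
    by ring.
  by rewrite dF F mulr0 mul0r addr0.
(* Likewise l/L - (m - l)/(M - L), from v = - L/(M - L). *)
- apply: (exact v m v0 erefl ((M * l - L * m) / (L * (M - L)))).
  rewrite derivation_div ?mulf_neq0 // (raddfB D) !DM !(raddfB D).
  apply: (mulIf (x := (L * (M - L)) ^+ 2)); first by rewrite expf_neq0 ?mulf_neq0.
  rewrite divfK; last by rewrite expf_neq0 ?mulf_neq0.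
  apply/eqP; rewrite -subr_eq0; apply/eqP.
  transitivity ((L * (M - L)) * (m * D L + M * D l - D m * L - D M * l
      - (l * M * (M - L) + L * m * (M - L) + L * M * (m - l)))
    + (M * D L - D M * L - L * M * (M - L)) * (2%:R * L * l - L * m - M * l)).
    by ring.
  by rewrite dF F mulr0 mul0r addr0.
Qed.

(** Descent: logarithmic derivatives show that p divides all exponents of a relation, and
    injectivity of Frobenius allows a p-th root to be taken. Hence every power of p divides the
    exponents. *)
Lemma monomial_relation_dvdn (s : nat) (J : 'I_s -> 'I_N) :
  (forall n : 'I_s -> int, \sum_j (n j)%:~R * lam (J j) = 0 ->
     \sum_j (n j)%:~R * mu (J j) = 0 -> forall j, (p %| `|n j|)%N) ->
  forall n : 'I_s -> int,
    \prod_j u (J j) ^ n j = 1 -> \prod_j v (J j) ^ n j = 1 -> forall j, n j = 0.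
Proof.
move=> J_free.
have log0 (x : 'I_N -> K) n : (forall i, x i != 0) -> \prod_j x (J j) ^ n j = 1 ->
    \sum_j (n j)%:~R * (D (x (J j)) / x (J j)) = 0.
  move=> x0 xn; have := @derivation_monomial _ D DM _ (index_enum _) (x \o J) n (fun j => x0 (J j)).
  by rewrite /= xn derivation1 // mul1r => <-.
have dvd k : forall n : 'I_s -> int,
    \prod_j u (J j) ^ n j = 1 -> \prod_j v (J j) ^ n j = 1 -> forall j, (p ^ k %| `|n j|)%N.
  elim: k => [|k IHk] n un vn j; first by rewrite expn0 dvd1n.
  have pn := J_free n (log0 u n u0 un) (log0 v n v0 vn).
  have /fin_all_exists[n' nE] l : exists m, n l = m * p%:Z.
    by have /dvdzP : (p%:Z %| n l)%Z by exact: pn.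
  have root1 (x : 'I_N -> K) : \prod_j x (J j) ^ n j = 1 -> \prod_j x (J j) ^ n' j = 1.
    move=> xn; apply: (fmorph_inj (frobenius hK 1)); rewrite rmorph1 -[RHS]xn rmorph_prod.
    by apply: eq_bigr => l _; rewrite /= /frobenius expn1 nE -exprz_exp.
  by rewrite nE abszM expnSr dvdn_mul ?IHk // root1.
move=> n un vn j; apply/eqP; rewrite -absz_eq0; apply: contraT; rewrite -lt0n => nj.
have := dvdn_leq nj (dvd `|n j|%N n un vn j).
by rewrite leqNgt ltn_expl // prime_gt1 // (pcharf_prime hK).
Qed.

(** The s equations are Frobenius twists of one cubic. Coordinates of the points lie in the prime
    field, so twisting the coefficients raises the value to a power of p and all twists vanish at
    the same points. The Jacobian there is the Moore matrix of the partial derivatives [w j], whose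
    independence over F_p comes from [log_form_free]. *)
Theorem solutions_bound_rank : exists (s : nat) (J : 'I_s -> 'I_N),
  (N <= 4 ^ s)%N /\ forall n : 'I_s -> int,
    \prod_j u (J j) ^ n j = 1 -> \prod_j v (J j) ^ n j = 1 -> forall j, n j = 0.
Proof.
have Kp (x : K * K) : x *+ p = 0.
  case: x => x y; suff: (x *+ p, y *+ p) = 0 :> K * K.
    by move=> <-; elim: p => [|k IHk]; rewrite ?mulr0n // !mulrS IHk.
  by rewrite !(mulrn_pchar hK).
have sumE (s : nat) (J : 'I_s -> 'I_N) (n : 'I_s -> int) :
    \sum_j (lam (J j), mu (J j)) *~ n j =
    (\sum_j (n j)%:~R * lam (J j), \sum_j (n j)%:~R * mu (J j)) :> K * K.
  rewrite [LHS]surjective_pairing !raddf_sum; congr (_, _); apply: eq_bigr => j _.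
    by rewrite raddfMz mulrzl.
  by rewrite raddfMz mulrzl.
have [s [J [J_free J_span]]] := extract_basis_mod (fun i => (lam i, mu i)) (pcharf_prime hK) Kp.
have {}J_free (n : 'I_s -> int) : \sum_j (n j)%:~R * lam (J j) = 0 ->
    \sum_j (n j)%:~R * mu (J j) = 0 -> forall j, (p %| `|n j|)%N.
  by move=> ln mn; apply: J_free; rewrite sumE ln mn.
have [m mP] := fin_all_exists J_span.
have {}mP i : lam i = \sum_j lam (J j) * (m i j)%:~R /\ mu i = \sum_j mu (J j) * (m i j)%:~R.
  have := mP i; rewrite sumE => -[-> ->].
  by split; apply: eq_bigr => j _; rewrite mulrC.
exists s, J; split; last exact: monomial_relation_dvdn.
pose z k j : K := (m k j)%:~R.
have zE k : [/\ \sum_j lam (J j) * z k j = lam k, \sum_j mu (J j) * z k j = mu k,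
    \sum_j D (lam (J j)) * z k j = D (lam k) & \sum_j D (mu (J j)) * z k j = D (mu k)].
  have [lk mk] := mP k; split=> //.
    by rewrite lk raddf_sum; apply: eq_bigr => j _; rewrite /= mulrC [lam _ * _]mulrC derivationZ.
  by rewrite mk raddf_sum; apply: eq_bigr => j _; rewrite /= mulrC [mu _ * _]mulrC derivationZ.
have frE i k (c : 'I_s -> K) :
    \sum_j frobenius hK i (c j) * z k j = frobenius hK i (\sum_j c j * z k j).
  by rewrite raddf_sum; apply: eq_bigr => j _; rewrite /= rmorphM /= frobenius_intr.
pose f i := cubic_mpoly (fun j => frobenius hK i (lam (J j))) (fun j => frobenius hK i (mu (J j)))
  (fun j => frobenius hK i (D (lam (J j)))) (fun j => frobenius hK i (D (mu (J j)))).
apply: (@nondegenerate_zeros_bound K s 3 N (fun i => f i) z) => [i|k l zkl|k i|k].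
- exact: cubic_mpoly_size.
- apply: u_inj; rewrite !uE; have [<- <- _ _] := zE k; have [<- <- _ _] := zE l.
  by rewrite !(eq_bigr _ (fun j _ => congr1 _ (zkl j))).
- rewrite cubic_mpoly_eval !frE; have [-> -> -> ->] := zE k.
  by rewrite -[RHS](rmorph0 (frobenius hK i)) -(cubic0 k) /cubic_form !(rmorphB, rmorphM) /=.
pose w j := cubic_form_diff (lam k) (mu k) (D (lam k)) (D (mu k))
  (lam (J j)) (mu (J j)) (D (lam (J j))) (D (mu (J j))).
have -> : \matrix_(i, j) (f i)^`M(j).@[z k] = \matrix_(i < s, j < s) w j ^+ (p ^ i).
  apply/matrixP => i j; rewrite !mxE cubic_mpoly_deriv_eval !frE; have [-> -> -> ->] := zE k.
  rewrite -[RHS]/(frobenius hK i (w j)) /w /cubic_form_diff.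
  by rewrite !(rmorphB, rmorphD, rmorphM).
apply: (moore_matrix_unit hK) => n nw.
have := @log_form_free s J n k; cbv zeta; set l := \sum_j _ * lam _; set m' := \sum_j _ * mu _.
have Dl : D l = \sum_j (n j)%:~R * D (lam (J j)).
  by rewrite raddf_sum; apply: eq_bigr => j _; rewrite /= derivationZ.
have Dm : D m' = \sum_j (n j)%:~R * D (mu (J j)).
  by rewrite raddf_sum; apply: eq_bigr => j _; rewrite /= derivationZ.
case=> [|l0 m0]; last exact: J_free.
rewrite -[RHS]nw Dl Dm.
by rewrite cubic_form_diff_sum.
Qed.

End Rank.

From mathcomp Require Import classical_sets functions cardinality.

(** * Existence of derivations of exponent p *)

Section Subfield.
Variable K : fieldType.

Definition is_subfield (A : set K) := [/\ A 1, forall x y, A x -> A y -> A (x - y),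
  forall x y, A x -> A y -> A (x * y) & forall x, A x -> A x^-1].

Variables (A : set K) (hA : is_subfield A).

Definition subfield_pred of is_subfield A : {pred K} := fun x => `[< A x >].

Lemma subfield_pred_closed : divring_closed (subfield_pred hA).
Proof.
have [A1 AB AM AV] := hA; split; first exact/asboolP.
  by move=> x y /asboolP Ax /asboolP Ay; apply/asboolP/AB.
by move=> x y /asboolP Ax /asboolP Ay; apply/asboolP/AM => //; apply: AV.
Qed.

HB.instance Definition _ :=
  GRing.isDivringClosed.Build K (subfield_pred hA) subfield_pred_closed.

Record subfield_type := SubfieldType { subfield_val : K; _ : subfield_val \in subfield_pred hA }.

HB.instance Definition _ := [isSub for subfield_val].
HB.instance Definition _ := [Choice of subfield_type by <:].
HB.instance Definition _ := [SubChoice_isSubIntegralDomain of subfield_type by <:].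
HB.instance Definition _ := [SubIntegralDomain_isSubField of subfield_type by <:].

(** Turns a subset of [K] into a field in its own right, so that polynomials and linear algebra over
    it become available. *)
Lemma subfield_embedding : exists (F : fieldType) (iota : {rmorphism F -> K}),
  forall x, A x <-> exists y, x = iota y.
Proof.
exists subfield_type, (val : {rmorphism subfield_type -> K}) => x; split=> [Ax|[y ->]].
  have xA : x \in subfield_pred hA by apply/asboolP.
  by exists (SubfieldType xA).
exact/asboolP/(valP y).
Qed.

End Subfield.

Section Adjunction.
Variables (K E : fieldType) (iota : {rmorphism E -> K}).
Implicit Types (x y z : K) (P Q : {poly E}).

Definition in_base x := exists e, x = iota e.

(** The ring E[y]; it is a field once [K] is purely inseparable of exponent one over [E]
    ([adjoin_subfield]). *)
Definition adjoin y : set K := fun z => exists P, z = (map_poly iota P).[y].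

Lemma adjoin_base y e : adjoin y (iota e).
Proof. by exists e%:P; rewrite map_polyC hornerC. Qed.

Lemma adjoin_id y : adjoin y y.
Proof. by exists 'X; rewrite map_polyX hornerX. Qed.

Lemma adjoinB y x z : adjoin y x -> adjoin y z -> adjoin y (x - z).
Proof. by move=> [P ->] [Q ->]; exists (P - Q); rewrite rmorphB hornerD hornerN. Qed.

Lemma adjoinM y x z : adjoin y x -> adjoin y z -> adjoin y (x * z).
Proof. by move=> [P ->] [Q ->]; exists (P * Q); rewrite rmorphM hornerM. Qed.

Lemma adjoinX y x n : adjoin y x -> adjoin y (x ^+ n).
Proof. by move=> [P ->]; exists (P ^+ n); rewrite rmorphXn horner_exp. Qed.

Lemma adjoin_trans x y z : adjoin y x -> adjoin x z -> adjoin y z.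
Proof.
by move=> [P ->] [Q ->]; exists (Q \Po P); rewrite map_comp_poly horner_comp.
Qed.

End Adjunction.

Lemma coef_XsubC_exp (R : comNzRingType) (a : R) k :
  (('X - a%:P) ^+ k.+1)`_k = - (a *+ k.+1).
Proof.
elim: k => [|k IHk]; first by rewrite expr1 coefB coefX coefC sub0r mulr1n.
have lead : (('X - a%:P) ^+ k.+1)`_k.+1 = 1.
  have /monicP := monic_exp k.+1 (monicXsubC a).
  by rewrite /lead_coef size_exp_XsubC.
by rewrite exprS mulrBl coefB coefXM coefCM IHk lead mulr1 [a *+ k.+2]mulrS opprD addrC.
Qed.

(** * Simple extensions E[y] when all p-th powers lie in E *)

Section PurelyInseparable.
Variables (p : nat) (K : fieldType) (hK : p \in [pchar K]).
Variables (E : fieldType) (iota : {rmorphism E -> K}).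
Hypothesis Kp : forall x : K, in_base iota (x ^+ p).
Implicit Types (x y z : K) (P Q : {poly E}).

Let p_pr : prime p := pcharf_prime hK.

Lemma pth_power_poly y : exists2 Q : {poly E}, map_poly iota Q = ('X - y%:P) ^+ p & size Q = p.+1.
Proof.
have [c yp] := Kp y; exists ('X^p - c%:P); last by rewrite size_XnsubC ?prime_gt0.
have hKX : p \in [pchar {poly K}] by rewrite pchar_poly.
rewrite -[RHS](pFrobenius_autE hKX) pFrobenius_autB_comm; last exact: mulrC.
by rewrite !pFrobenius_autE -rmorphXn yp rmorphB /= map_polyXn map_polyC.
Qed.

(** Over [K], the gcd of a nonzero [P] with X^p - y^p is a constant times a power of X - y with
    exponent strictly between 0 and p. Its two top coefficients lie in [E] and determine y, the
    exponent being invertible. *)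
Lemma low_degree_relation y P : ~ in_base iota y -> (size P <= p)%N ->
  (map_poly iota P).[y] = 0 -> P = 0.
Proof.
move=> yE sP Py; apply/eqP; apply: contraT => P0; exfalso; apply: yE.
have [Q QE _] := pth_power_poly y.
pose G := gcdp P Q.
have : map_poly iota G %| ('X - y%:P) ^+ p by rewrite -QE dvdp_map dvdp_gcdr.
case/dvdp_exp_XsubCP => k _ Gk.
have G0 : G != 0 by rewrite gcdp_eq0 negb_and P0.
have sG : size G = k.+1 by rewrite -(size_map_poly iota) (eqp_size Gk) size_exp_XsubC.
have ltkp : (k < p)%N.
  by rewrite -sG; apply: leq_trans sP; rewrite dvdp_leq ?dvdp_gcdl.
have : root (map_poly iota G) y.
  rewrite gcdp_map root_gcd; apply/andP; split; first exact/rootP.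
  by rewrite QE; apply/rootP; rewrite horner_exp hornerXsubC subrr expr0n gtn_eqF ?prime_gt0.
rewrite (eqp_root Gk); case: k => [|k] in ltkp sG Gk *; first by rewrite expr0 (negPf (root1 _)).
move=> _; have /eqpf_eq[c c0 Gc] := Gk.
have cE : c = iota G`_k.+1.
  rewrite -coef_map Gc coefZ; have /monicP := monic_exp k.+1 (monicXsubC y).
  by rewrite /lead_coef size_exp_XsubC => ->; rewrite mulr1.
exists (- (G`_k / (G`_k.+1 *+ k.+1))).
rewrite rmorphN fmorph_div rmorphMn -cE -coef_map Gc coefZ coef_XsubC_exp.
have k0 : k.+1%:R != 0 :> K.
  by rewrite -(dvdn_pcharf hK); apply: contraL ltkp => /dvdn_leq; rewrite -leqNgt; apply.
rewrite -[c *+ _]mulr_natr -[y *+ _]mulr_natr; move: (k.+1%:R) k0 => n n0.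
by field; rewrite n0 c0.
Qed.

Lemma adjoin_low_degree y x : adjoin iota y x ->
  exists2 P : {poly E}, (size P <= p)%N & x = (map_poly iota P).[y].
Proof.
move=> [P ->]; have [Q QE sQ] := pth_power_poly y.
have Q0 : Q != 0 by rewrite -size_poly_eq0 sQ.
exists (P %% Q); first by rewrite -ltnS -sQ ltn_modp.
rewrite {1}(divp_eq P Q) rmorphD rmorphM /= hornerD hornerM QE horner_exp hornerXsubC subrr.
by rewrite expr0n gtn_eqF ?prime_gt0 // mulr0 add0r.
Qed.

Lemma adjoin_subfield y : is_subfield (adjoin iota y).
Proof.
split; [|exact: adjoinB|exact: adjoinM|].
  by rewrite -(rmorph1 iota); apply: adjoin_base.
move=> x yx; have [->|x0] := eqVneq x 0; first by rewrite invr0 -(rmorph0 iota); apply: adjoin_base.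
 have [c xp] := Kp x.
have -> : x^-1 = x ^+ p.-1 * iota c^-1.
  rewrite fmorphV -xp -{2}(prednK (prime_gt0 p_pr)) exprS invfM mulrCA divff ?mulr1 //.
  by rewrite expf_neq0.
by apply: adjoinM; [apply: adjoinX|apply: adjoin_base].
Qed.

(** The p + 1 elements y, 1, x, ..., x^(p-1) of E[y], a space of dimension at most p, are dependent.
    The relation involves y, because the powers of x alone are independent by
    [low_degree_relation]. *)
Lemma adjoin_exchange x y : adjoin iota y x -> ~ in_base iota x -> adjoin iota x y.
Proof.
move=> yx xE; have p_gt1 := prime_gt1 p_pr.
pose a (i : option 'I_p) := if i is Some j then x ^+ j else y.
have ya i : adjoin iota y (a i) by case: i => [i|]; [exact: adjoinX|exact: adjoin_id].
have /fin_all_exists2[Q sQ QE] i := adjoin_low_degree (ya i).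
have [|c [[i ci] cQ]] := @linear_dependence E _ _ (fun i (j : 'I_p) => (Q i)`_j).
  by rewrite card_option card_ord.
have cQ0 : \sum_i c i *: Q i = 0.
  apply/polyP => k; rewrite coef0 coef_sum; under eq_bigr do rewrite coefZ.
  case: (ltnP k p) => [ltkp|lepk]; first exact: (cQ (Ordinal ltkp)).
  by rewrite big1 // => j _; rewrite nth_default ?mulr0 // (leq_trans (sQ j)).
pose R := \poly_(k < p) oapp (c \o Some) 0 (insub k).
have RE : (map_poly iota R).[x] = \sum_(k < p) iota (c (Some k)) * x ^+ k.
  rewrite (@horner_coef_wide _ p) ?size_map_poly ?size_poly //.
  by apply: eq_bigr => k _; rewrite coef_map coef_poly ltn_ord valK.
have : (map_poly iota R).[x] + iota (c None) * y = 0.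
  have := congr1 (fun P => (map_poly iota P).[y]) cQ0.
  rewrite rmorph0 horner0 rmorph_sum horner_sum (bigD1 None) //= => <-.
  rewrite addrC; congr (_ + _); last by rewrite map_polyZ hornerZ -(QE None).
  rewrite RE (reindex_omap Some id) => [|[]//].
  by apply: eq_big => [k|k _]; [rewrite eqxx|rewrite map_polyZ hornerZ -(QE (Some k))].
have [cN|cN] := eqVneq (c None) 0.
  rewrite cN rmorph0 mul0r addr0 => /(low_degree_relation xE (size_poly _ _))/polyP R0.
  case/eqP: ci; case: i => [k|//]; have := R0 k.
  by rewrite coef_poly ltn_ord coef0 valK.
move/eqP; rewrite addr_eq0 => /eqP Ry.
have -> : y = iota (- (c None)^-1) * (map_poly iota R).[x].
  by rewrite Ry mulrN rmorphN mulNr opprK mulrA -rmorphM mulVf // rmorph1 mul1r.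
by apply: adjoinM; [exact: adjoin_base|exists R].
Qed.

(** Relations of y are multiples of X^p - y^p, whose derivative is zero; this makes d/dy well
    defined on E[y]. *)
Lemma relation_deriv y P : ~ in_base iota y -> (map_poly iota P).[y] = 0 ->
  (map_poly iota P^`()).[y] = 0.
Proof.
move=> yE Py; have [Q QE sQ] := pth_power_poly y.
have Q0 : Q != 0 by rewrite -size_poly_eq0 sQ.
have Qy : (map_poly iota Q).[y] = 0.
  by rewrite QE horner_exp hornerXsubC subrr expr0n gtn_eqF ?prime_gt0.
have Q'y : (map_poly iota Q^`()).[y] = 0.
  rewrite -deriv_map QE deriv_exp -mulrnAr.
  by rewrite -[_ *+ p]mulr_natr -polyC_natr (pcharf0 hK) !mulr0 horner0.
have PQ : P %% Q = 0.
  apply: (low_degree_relation yE); first by rewrite -ltnS -sQ ltn_modp.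
  by rewrite -Py [in RHS](divp_eq P Q) rmorphD rmorphM /= hornerD hornerM Qy mulr0 add0r.
rewrite (divp_eq P Q) PQ addr0 derivM rmorphD !rmorphM /= hornerD !hornerM Qy Q'y.
by rewrite !mulr0 addr0.
Qed.

(** Take D = d/dy. A p-th derivative carries the factor p! = 0, and a polynomial of degree below p
    with zero derivative is constant. *)
Lemma adjoin_derivation y : ~ in_base iota y -> (forall x, adjoin iota y x) ->
  exists D : {additive K -> K}, [/\ forall a b, D (a * b) = D a * b + a * D b,
    forall x, iter p D x = 0 & forall x, D x = 0 -> in_base iota x].
Proof.
move=> yE /choice[f fE].
pose D x := (map_poly iota (f x)^`()).[y].
have DE P : D (map_poly iota P).[y] = (map_poly iota P^`()).[y].
  apply/eqP; rewrite -subr_eq0 -hornerN -hornerD -rmorphB -derivB; apply/eqP.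
  by apply: relation_deriv yE _; rewrite rmorphB hornerD hornerN -fE subrr.
have DB : zmod_morphism D.
  move=> a b; rewrite {1}(fE a) {1}(fE b) -hornerN -hornerD -rmorphB DE.
  by rewrite derivB rmorphB hornerD hornerN.
have DM a b : D (a * b) = D a * b + a * D b.
  rewrite {1}(fE a) {1}(fE b) -hornerM -rmorphM DE derivM rmorphD !rmorphM /=.
  by rewrite hornerD !hornerM -!fE.
have DnE k P : iter k D (map_poly iota P).[y] = (map_poly iota P^`(k)).[y].
  by elim: k => [|k IHk] //=; rewrite IHk DE.
have Dp x : iter p D x = 0.
  rewrite (fE x) DnE nderivn_def rmorphMn hornerMn /=.
  by rewrite -(prednK (prime_gt0 p_pr)) factS prednK ?prime_gt0 // mulrnA (mulrn_pchar hK) mul0rn.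
have Dconst x : D x = 0 -> in_base iota x.
  have [P sP ->] := adjoin_low_degree (ex_intro _ (f x) (fE x)).
  rewrite DE => /(low_degree_relation yE) P'0.
  have {}P'0 : P^`() = 0.
    by apply: P'0; apply: leq_trans sP; apply: leq_trans (size_poly _ _) (leq_pred _).
  exists P`_0; rewrite (_ : P = (P`_0)%:P) ?map_polyC ?hornerC ?coefC //.
  apply/polyP => -[|k]; rewrite coefC //=.
  case: (ltnP k.+1 p) => [ltkp|lepk]; last by rewrite nth_default // (leq_trans sP).
  have /polyP/(_ k) := P'0; rewrite coef_deriv coef0 -mulr_natr => /eqP.
  rewrite mulf_eq0 => /orP[/eqP//|/eqP/(congr1 iota)]; rewrite rmorph_nat rmorph0 => /eqP.
  rewrite -(dvdn_pcharf hK) => /(dvdn_leq (ltn0Sn k)).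
  by rewrite leqNgt ltkp.
pose mD := GRing.isZmodMorphism.Build K K D DB.
by exists (HB.pack D mD : {additive K -> K}).
Qed.

End PurelyInseparable.

Section SeparatingDerivation.
Variables (p : nat) (K : fieldType) (hK : p \in [pchar K]).
Let p_pr : prime p := pcharf_prime hK.

Lemma maximal_subfield (S : set K) : (forall x, S x -> ~ exists y, x = y ^+ p) ->
  exists A : set K, [/\ is_subfield A, forall x, A (x ^+ p), forall x, S x -> ~ A x &
    forall B : set K, is_subfield B -> (A `<=` B)%classic -> (forall x, S x -> ~ B x) ->
      (B `<=` A)%classic].
Proof.
move=> S_pth.
pose good (A : set K) := [/\ is_subfield A, forall x, A (x ^+ p) & forall x, S x -> ~ A x].
pose P (A : set K) := A = set0 \/ good A.
have good_pth : good (fun x => exists y, x = y ^+ p).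
  split=> [|x|//]; last by exists x.
  split=> [|_ _ [x ->] [y ->]|_ _ [x ->] [y ->]|_ [x ->]].
  - by exists 1; rewrite expr1n.
  - by exists (x - y); rewrite -!(pFrobenius_autE hK) rmorphB.
  - by exists (x * y); rewrite exprMn.
  - by exists x^-1; rewrite exprVn.
have [F FP F_total|A [PA Amax]] := @Zorn_bigcup K P.
  have [[X0 FX0 X00]|F0] := pselect (exists2 X, F X & X <> set0); last first.
    left; apply/seteqP; split=> // x [X FX Xx]; case: F0; exists X => // X0.
    by rewrite X0 in Xx.
  have F_good X : F X -> X <> set0 -> good X by move=> /FP[].
  right; have [[X01 _ _ _] X0p _] := F_good X0 FX0 X00.
  have common x y : (\bigcup_(X in F) X)%classic x -> (\bigcup_(X in F) X)%classic y ->
      exists X, [/\ F X, good X, X x & X y].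
    move=> [X FX Xx] [Y FY Yy].
    have [XY|YX] := F_total X Y FX FY.
      by exists Y; split=> //; [apply: F_good => // Y0; rewrite Y0 in Yy|exact: XY].
    by exists X; split=> //; [apply: F_good => // X_0; rewrite X_0 in Xx|exact: YX].
  split=> [|x|x Sx [X FX Xx]].
  - split=> [|x y Ux Uy|x y Ux Uy|x Ux]; first by exists X0.
    + by have [X [FX [[_ XB _ _] _ _] Xx Xy]] := common x y Ux Uy; exists X => //; apply: XB.
    + by have [X [FX [[_ _ XM _] _ _] Xx Xy]] := common x y Ux Uy; exists X => //; apply: XM.
    + by have [X [FX [[_ _ _ XV] _ _] Xx _]] := common x x Ux Ux; exists X => //; apply: XV.
  - by exists X0 => //; apply: X0p.
  - have [|_ _ XS] := F_good X FX; first by move=> X_0; rewrite X_0 in Xx.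
    exact: XS Xx.
have [A0|[subA Ap AS]] := PA.
  exfalso; apply: (Amax _ _ (or_intror good_pth)); rewrite A0; split=> //.
  by move=> /(_ 1); apply; have [[]] := good_pth.
exists A; split=> // B subB AB BS; apply: contrapT => BA.
apply: (Amax B); first by split.
by right; split=> // x; apply: AB.
Qed.

(* [E] is a maximal subfield containing the p-th powers and avoiding the [u i].
   Every [adjoin iota y] with [y] outside [E] then meets the [u i], so by exchange the
   finitely many [adjoin iota (u i)] cover [K]; as [E] is infinite, one of them is [K]. *)
Theorem separating_derivation (N : nat) (u : 'I_N -> K) :
  (forall i, ~ exists y, u i = y ^+ p) ->
  exists D : {additive K -> K}, [/\ forall a b, D (a * b) = D a * b + a * D b,
    forall x, iter p D x = 0 & forall i, D (u i) != 0].
Proof.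
move=> u_pth.
have [A [subA Ap AS Amax]] : exists A : set K, [/\ is_subfield A, forall x, A (x ^+ p),
    forall x, (exists i, x = u i) -> ~ A x & forall B : set K, is_subfield B ->
      (A `<=` B)%classic -> (forall x, (exists i, x = u i) -> ~ B x) -> (B `<=` A)%classic].
  by apply: (@maximal_subfield (fun x => exists i, x = u i)) => x [i ->].
have [E [iota AE]] := subfield_embedding subA.
have Kp x : in_base iota (x ^+ p) by apply/AE.
have uE i : ~ in_base iota (u i) by move=> /AE; apply: AS; exists i.
have cover y : ~ in_base iota y -> exists i, adjoin iota (u i) y.
  move=> yE; have [i ui] : exists i, adjoin iota y (u i).
    apply: contrapT => yu; apply: yE; apply/AE; apply: (Amax (adjoin iota y)).
    - exact: (adjoin_subfield hK Kp).
    - by move=> x /AE[e ->]; apply: adjoin_base.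
    - by move=> _ [i ->] ui; apply: yu; exists i.
    - exact: adjoin_id.
  by exists i; apply: (adjoin_exchange hK Kp ui).
case: (posnP N) => [N0|N_gt0].
  exists (\0 : {additive K -> K}); split=> [a b|x|i].
  - by rewrite /= mul0r mulr0 addr0.
  - by rewrite -(prednK (prime_gt0 p_pr)).
  - by have := ltn_ord i; rewrite {2}N0.
pose i0 := Ordinal N_gt0.
(* An infinite supply of elements of [E]: two equal ones would make [u i0] a p-th power. *)
pose c j : K := u i0 ^+ (p ^ j.+1).
have c_inj i j : c i = c j -> (i <= j)%N.
  move=> cij; rewrite leqNgt; apply/negP => ltji.
  have : frobenius hK j.+1 (u i0 ^+ (p ^ (i - j))) = frobenius hK j.+1 (u i0).
    by rewrite /frobenius -exprM -expnD addnS subnK ?(ltnW ltji).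
  move/fmorph_inj => ui; apply: (u_pth i0); exists (u i0 ^+ (p ^ (i - j).-1)).
  by rewrite -exprM -expnSr prednK ?subn_gt0.
have /choice[e eE] j : exists d, c j = iota d by rewrite /c expnSr exprM; apply: Kp.
have full x : adjoin iota (u i0) x.
  apply: contrapT => xu.
  (* Pigeonhole: two of these N + 1 elements lie in the same E[u i], which then contains x and
     [u i0]. By exchange it lies in E[u i0], so x does too. *)
  have line (j : 'I_N.+1) : exists i, adjoin iota (u i) (u i0 + c j * x).
    apply: cover => -[d ux]; apply: xu.
    have c0 : c j != 0.
      rewrite expf_neq0 //; apply/eqP => ui; apply: (u_pth i0); exists 0.
      by rewrite ui expr0n gtn_eqF ?prime_gt0.
    have -> : x = iota (e j)^-1 * (iota d - u i0).
      by rewrite -ux fmorphV -eE [_ + _ - _]addrC addKr mulKf.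
    apply: adjoinM; first exact: adjoin_base.
    by apply: adjoinB; [exact: adjoin_base|exact: adjoin_id].
  have [h hP] := fin_all_exists line.
  have [j [l [jl hjl]]] : exists j l, j != l /\ h j = h l.
    apply: contrapT => h_inj; have /leq_card : injective h.
      move=> j l hjl; apply/eqP; apply: contrapT => /negP jl; apply: h_inj.
      by exists j, l.
    by rewrite !card_ord ltnn.
  have cjl : e j - e l != 0.
    rewrite -(fmorph_eq0 iota) rmorphB -!eE subr_eq0; apply: contraNneq jl => cjl.
    by apply/eqP/val_inj/eqP; rewrite eqn_leq !c_inj.
  have hx : adjoin iota (u (h j)) x.
    have -> : x = iota (e j - e l)^-1 * ((u i0 + c j * x) - (u i0 + c l * x)).
      rewrite opprD addrACA subrr add0r -mulrBl !eE -rmorphB mulrA -rmorphM mulVf //.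
      by rewrite rmorph1 mul1r.
    apply: adjoinM; [exact: adjoin_base|apply: adjoinB; first exact: hP].
    by rewrite hjl; apply: hP.
  apply: xu; apply: (adjoin_trans _ hx); apply: (adjoin_exchange hK Kp _ (uE i0)).
  have -> : u i0 = (u i0 + c j * x) - iota (e j) * x by rewrite -eE addrK.
  by apply: adjoinB; [exact: hP|apply: adjoinM => //; apply: adjoin_base].
have [D [DM Dp Dc]] := adjoin_derivation hK Kp (uE i0) full.
by exists D; split=> // i; apply/eqP => /Dc; apply: uE.
Qed.

End SeparatingDerivation.

(** * Frobenius roots in finitely generated fields *)

Lemma monic_sub_size (R : nzRingType) (P Q : {poly R}) :
  P \is monic -> Q \is monic -> size Q = size P -> (size (P - Q)%R < size P)%N.
Proof.
move=> Pm Qm sQP; have : (0 < size P)%N by rewrite size_poly_gt0 monic_neq0.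
move/monicP: Pm; move/monicP: Qm; rewrite /lead_coef sQP.
case sP: (size P) => [|k] //= Qk Pk _; rewrite ltnS; apply/leq_sizeP => j.
rewrite leq_eqVlt coefB => /orP[/eqP<-|ltkj]; first by rewrite Pk Qk subrr.
by rewrite !nth_default ?subrr // ?sQP sP.
Qed.

Section FinitelyGenerated.
Variables (p : nat) (K : fieldType) (hK : p \in [pchar K]).
Let p_pr : prime p := pcharf_prime hK.

Definition divisible_in (A : set K) x := forall k, exists2 u, A u & x = u ^+ (p ^ k).

(** The property passed on when a generator is adjoined: infinitely p-divisible elements are
    algebraic over the prime field. *)
Definition divisible_algebraic (A : set K) := forall x, A x -> divisible_in A x ->
  exists2 n, (0 < n)%N & x ^+ (p ^ n) = x.

(** * Infinitely p-divisible elements of a simple extension E(y) *)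

Section Adjoin.
Variables (E : fieldType) (iota : {rmorphism E -> K}) (y : K).

Let ev P := (map_poly iota P).[y].

Definition adjoin_field : set K := fun z => exists2 PR : {poly E} * {poly E},
  ev PR.2 != 0 & z = ev PR.1 / ev PR.2.

Let evB P Q : ev (P - Q) = ev P - ev Q.
Proof. by rewrite /ev rmorphB hornerD hornerN. Qed.

Let evM P Q : ev (P * Q) = ev P * ev Q.
Proof. by rewrite /ev rmorphM hornerM. Qed.

Let evX P n : ev (P ^+ n) = ev P ^+ n.
Proof. by rewrite /ev rmorphXn horner_exp. Qed.

Let evC c : ev c%:P = iota c.
Proof. by rewrite /ev map_polyC hornerC. Qed.

Lemma adjoin_field_base c : adjoin_field (iota c).
Proof. by exists (c%:P, 1); rewrite /= -polyC1 !evC rmorph1 ?oner_neq0 ?divr1. Qed.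

Lemma adjoin_field_id : adjoin_field y.
Proof.
by exists ('X, 1); rewrite /= -polyC1 evC rmorph1 ?oner_neq0 // /ev map_polyX hornerX divr1.
Qed.

Lemma adjoin_field_subfield : is_subfield adjoin_field.
Proof.
split=> [|_ _ [[P R] /= R0 ->] [[P' R'] /= R'0 ->]|
  _ _ [[P R] /= R0 ->] [[P' R'] /= R'0 ->]|_ [[P R] /= R0 ->]].
- by rewrite -(rmorph1 iota); apply: adjoin_field_base.
- exists (P * R' - P' * R, R * R'); rewrite /= ?evB !evM ?mulf_neq0 //.
  by field; rewrite R0 R'0.
- exists (P * P', R * R'); rewrite /= !evM ?mulf_neq0 //.
  by field; rewrite R0 R'0.
- have [P0|P0] := eqVneq (ev P) 0.
    by rewrite P0 mul0r invr0 -(rmorph0 iota); apply: adjoin_field_base.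
  by exists (R, P); rewrite //= invf_div.
Qed.

Hypothesis E_div : divisible_algebraic (in_base iota).

(** Write x = P/R and a p^k-th root of x as S/T in lowest terms. Then S^(p^k) divides P and T^(p^k)
    divides R, so for large k both S and T are constants. Thus x has all its roots in [E]. *)
Lemma divisible_adjoin_transcendental : (forall P, ev P = 0 -> P = 0) ->
  divisible_algebraic adjoin_field.
Proof.
move=> y_tr x [[P R] /= R0 xE] x_div.
have [x0|x0] := eqVneq x 0.
  by exists 1%N; rewrite // x0 expr0n expn1 gtn_eqF ?prime_gt0.
have ev_inj Q Q' : ev Q = ev Q' -> Q = Q'.
  by move=> QQ'; apply/eqP; rewrite -subr_eq0; apply/eqP/y_tr; rewrite evB QQ' subrr.
have nz_poly Q : ev Q != 0 -> Q != 0.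
  by apply: contraNneq => ->; rewrite /ev rmorph0 horner0.
have P0 : P != 0.
  by apply: nz_poly; apply: contraNneq x0 => P0; rewrite xE P0 mul0r.
have size_dvd (Q S : {poly E}) k :
    S != 0 -> (size S <= k)%N -> Q ^+ (p ^ k) %| S -> (size Q <= 1)%N.
  move=> S0 Sk /(dvdp_leq S0) QS; rewrite leqNgt; apply/negP => Q1.
  have Q0 : Q != 0 by rewrite -size_poly_gt0 (ltn_trans _ Q1).
  have := leq_trans QS Sk; rewrite leqNgt => /negP; apply.
  have := size_exp Q (p ^ k); have := ltn_expl k (prime_gt1 p_pr).
  case: (size Q) Q1 => [|[|n]] // _ ltk; rewrite /= mulSn => sQ.
  by move: (size (Q ^+ (p ^ k))) sQ ltk => [|m] /=; lia.
have root_base k : (size P <= k)%N -> (size R <= k)%N ->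
    exists2 u, in_base iota u & x = u ^+ (p ^ k).
  move=> Pk Rk; have [u [[S T] /= T0 uE] xu] := x_div k.
  have S0 : ev S != 0.
    apply: contraNneq x0 => S0; rewrite xu uE S0 mul0r expr0n.
    by rewrite gtn_eqF // expn_gt0 prime_gt0.
  have rel : P * T ^+ (p ^ k) = R * S ^+ (p ^ k).
    apply: ev_inj; rewrite !evM !evX; move: xu; rewrite xE uE expr_div_n => /eqP.
    by rewrite eqr_div ?expf_neq0 // => /eqP->; rewrite mulrC.
  pose G := gcdp S T.
  have G0 : G != 0 by rewrite gcdp_eq0 negb_and (nz_poly _ S0).
  have [S1 SE] : exists S1, S = S1 * G by apply/dvdpP/dvdp_gcdl.
  have [T1 TE] : exists T1, T = T1 * G by apply/dvdpP/dvdp_gcdr.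
  have S1T1 : coprimep S1 T1.
    have := coprimep_div_gcd (p := S) (q := T); rewrite (nz_poly _ S0) => /(_ isT).
    by rewrite -[S1](mulpK _ G0) -[T1](mulpK _ G0) -SE -TE.
  have rel1 : P * T1 ^+ (p ^ k) = R * S1 ^+ (p ^ k).
    move: rel; rewrite SE TE !exprMn !mulrA => /mulIf; apply.
    by rewrite expf_neq0.
  have sS1 : (size S1 <= 1)%N.
    apply: (size_dvd _ P k) => //.
    have : S1 ^+ (p ^ k) %| P * T1 ^+ (p ^ k) by rewrite rel1 dvdp_mull.
    by rewrite Gauss_dvdpl // coprimep_expl // coprimep_expr.
  have sT1 : (size T1 <= 1)%N.
    apply: (size_dvd _ R k) => //; first exact: nz_poly.
    have : T1 ^+ (p ^ k) %| R * S1 ^+ (p ^ k) by rewrite -rel1 dvdp_mull.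
    by rewrite Gauss_dvdpl // coprimep_expl // coprimep_expr // coprimep_sym.
  exists u => //; exists (S1`_0 / T1`_0).
  have evG : ev G != 0 by apply: contraNneq T0 => G1; rewrite TE evM G1 mulr0.
  rewrite uE SE TE !evM -mulf_div divff // mulr1 fmorph_div -!evC.
  by rewrite -(size1_polyC sS1) -(size1_polyC sT1).
pose m := maxn (size P) (size R).
have x_base k : exists2 u, in_base iota u & x = u ^+ (p ^ k).
  have [||u [e ue] xu] := root_base (maxn m k).
  - by rewrite !leq_max leqnn.
  - by rewrite !leq_max leqnn !orbT.
  exists (u ^+ (p ^ (maxn m k - k))).
    by exists (e ^+ (p ^ (maxn m k - k))); rewrite rmorphXn ue.
  by rewrite -exprM -expnD subnK ?leq_maxr.
apply: (E_div _ x_base); have [u [e ->] ->] := x_base 0%N; by exists e; rewrite expr1.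
Qed.

Definition annihilates Q z := Q != 0 /\ (map_poly iota Q).[z] = 0.

(** For z = S/R and d the degree of [P0], the d + 1 products S^i R^(d-i) are dependent modulo [P0];
    dividing by R^d gives a relation between powers of z. *)
Lemma bounded_degree P0 : P0 != 0 -> ev P0 = 0 -> forall z, adjoin_field z ->
  exists2 Q, annihilates Q z & (size Q <= size P0)%N.
Proof.
move=> P0_neq0 P0y z [[S R] /= R0 zE].
have sP0 : (0 < (size P0).-1)%N.
  rewrite -subn1 subn_gt0 ltnNge; apply: contra P0_neq0 => sP0.
  by move: P0y; rewrite (size1_polyC sP0) evC => /eqP; rewrite fmorph_eq0 => /eqP->.
set d := (size P0).-1 in sP0.
have sP0E : size P0 = d.+1 by rewrite /d prednK // size_poly_gt0.
pose F (i : 'I_d.+1) := S ^+ i * R ^+ (d - i).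
have [|c [[i ci] cF]] := @linear_dependence E _ _ (fun i (j : 'I_d) => (F i %% P0)`_j).
  by rewrite !card_ord.
have sF j : (size (F j %% P0)%R <= d)%N by rewrite -ltnS -sP0E ltn_modp.
have cF0 : \sum_i c i *: (F i %% P0) = 0.
  apply/polyP => k; rewrite coef0 coef_sum; under eq_bigr do rewrite coefZ.
  case: (ltnP k d) => [ltkd|ledk]; first exact: (cF (Ordinal ltkd)).
  by rewrite big1 // => j _; rewrite nth_default ?mulr0 // (leq_trans (sF j)).
exists (\poly_(i < d.+1) c (inord i)); last by rewrite sP0E size_poly.
split.
  by apply: contraNneq ci => /polyP/(_ i); rewrite coef_poly ltn_ord coef0 inord_val => ->.
rewrite (@horner_coef_wide _ d.+1) ?size_map_poly ?size_poly //.
apply: (mulIf (x := ev R ^+ d)); first by rewrite expf_neq0.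
rewrite mul0r mulr_suml.
transitivity (ev (\sum_i c i *: (F i %% P0))); last by rewrite cF0 /ev rmorph0 horner0.
rewrite /ev rmorph_sum horner_sum; apply: eq_bigr => j _ /=.
rewrite map_polyZ hornerZ coef_map coef_poly ltn_ord inord_val.
rewrite -/(ev (F j %% P0)) -mulrA; congr (_ * _).
have -> : ev (F j %% P0) = ev (F j).
  rewrite [in RHS](divp_eq (F j) P0) /ev rmorphD rmorphM /= hornerD hornerM.
  by rewrite -/(ev P0) P0y mulr0 add0r.
rewrite evM !evX zE -/(ev R) -[X in _ * _ ^+ X = _](subnK (leq_ord j)).
by rewrite expr_div_n exprD [_ * ev R ^+ j]mulrC mulrA divfK ?expf_neq0.
Qed.

(* The degrees of the minimal polynomials of the roots [u k] of [x] are nondecreasing and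
   bounded.  Once they are stationary, each minimal polynomial is a Frobenius twist of the
   next ones, so its coefficients are divisible in [E], hence fixed by a power of Frobenius. *)
Lemma divisible_adjoin_algebraic P0 : P0 != 0 -> ev P0 = 0 -> divisible_algebraic adjoin_field.
Proof.
move=> P0_neq0 P0y x xB x_div.
have hE : p \in [pchar E] by rewrite -(fmorph_pchar iota).
have frob_map j Q z : (map_poly iota (map_poly (frobenius hE j) Q)).[z ^+ (p ^ j)] =
    (map_poly iota Q).[z] ^+ (p ^ j).
  rewrite !horner_coef !size_map_poly -[RHS]/(frobenius hK j _) rmorph_sum.
  apply: eq_bigr => i _; rewrite /= rmorphM /= !coef_map /= /frobenius rmorphXn.
  by rewrite -!exprM mulnC.
have minpoly z : adjoin_field z -> exists2 Q, annihilates Q z &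
    Q \is monic /\ forall R, annihilates R z -> (size Q <= size R)%N.
  move=> /(bounded_degree P0_neq0 P0y)[Q0 Q0z _].
  pose ann n := `[< exists2 Q, annihilates Q z & size Q = n >].
  have ex_ann : exists n, ann n by exists (size Q0); apply/asboolP; exists Q0.
  case: (ex_minnP ex_ann) => _ /asboolP[Q [Q_neq0 Qz] <-] Qmin.
  have lc0 : (lead_coef Q)^-1 != 0 by rewrite invr_eq0 lead_coef_eq0.
  exists ((lead_coef Q)^-1 *: Q).
    by split; rewrite ?scaler_eq0 ?negb_or ?lc0 // map_polyZ hornerZ Qz mulr0.
  split; first by rewrite monicE lead_coefZ mulVf // lead_coef_eq0.
  by move=> R Rz; rewrite size_scale //; apply: Qmin; apply/asboolP; exists R.
have /choice[u uP] k : exists u, adjoin_field u /\ x = u ^+ (p ^ k).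
  by have [u uB xu] := x_div k; exists u.
have uD k j : u k = u (j + k)%N ^+ (p ^ j).
  apply: (fmorph_inj (frobenius hK k)); rewrite /= /frobenius -exprM -expnD.
  by have [_ <-] := uP k; have [_ <-] := uP (j + k)%N.
have /choice[Q QP] k : exists Q, [/\ annihilates Q (u k), Q \is monic &
    forall R, annihilates R (u k) -> (size Q <= size R)%N].
  by have [Q Qu [Qm Qmin]] := minpoly _ (uP k).1; exists Q.
have Q_frob k j : annihilates (map_poly (frobenius hE j) (Q (j + k)%N)) (u k).
  have [[Q0 Qu] _ _] := QP (j + k)%N; split; first by rewrite map_poly_eq0.
  by rewrite (uD k j) frob_map Qu expr0n gtn_eqF // expn_gt0 prime_gt0.
have size_Q_mono k j : (size (Q k) <= size (Q (j + k)%N))%N.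
  by have [_ _ /(_ _ (Q_frob k j))] := QP k; rewrite size_map_poly.
have size_Q_bound k : (size (Q k) <= size P0)%N.
  have [R Ru sR] := bounded_degree P0_neq0 P0y (uP k).1.
  by apply: leq_trans sR; have [_ _] := QP k; apply.
have [k0 k0P] : exists k0, forall k, (size (Q k) <= size (Q k0))%N.
  pose att n := `[< exists k, size (Q k) = n >].
  have ex_att : exists n, att n by exists (size (Q 0%N)); apply/asboolP; exists 0%N.
  have att_bound n : att n -> (n <= size P0)%N by move=> /asboolP[k <-]; apply: size_Q_bound.
  case: (ex_maxnP ex_att att_bound) => _ /asboolP[k0 <-] k0P.
  by exists k0 => k; apply: k0P; apply/asboolP; exists k.
have Q_eq j : Q k0 = map_poly (frobenius hE j) (Q (j + k0)%N).
  have [[Q0 Qu] Qm Qmin] := QP k0; have [R0 Ru] := Q_frob k0 j.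
  have [_ Rm _] := QP (j + k0)%N.
  have sR : size (map_poly (frobenius hE j) (Q (j + k0)%N)) = size (Q k0).
    by rewrite size_map_poly; apply/eqP; rewrite eqn_leq k0P size_Q_mono.
  apply/eqP; rewrite -subr_eq0; apply: contraT => QR.
  have /Qmin : annihilates (Q k0 - map_poly (frobenius hE j) (Q (j + k0)%N)) (u k0).
    by split=> //; rewrite rmorphB hornerD hornerN Qu Ru subrr.
  rewrite leqNgt => /negP[]; by apply: monic_sub_size; rewrite ?map_monic.
have coef_div i : divisible_in (in_base iota) (iota (Q k0)`_i).
  move=> j; exists (iota (Q (j + k0)%N)`_i); first by exists (Q (j + k0)%N)`_i.
  by rewrite (Q_eq j) coef_map /= /frobenius rmorphXn.
have /choice[n nP] i : exists n, (0 < n)%N /\ (Q k0)`_i ^+ (p ^ n) = (Q k0)`_i.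
  have [n n0 ni] := E_div (ex_intro _ _ erefl) (coef_div i).
  by exists n; split=> //; apply: (fmorph_inj iota); rewrite rmorphXn.
(* A common period of the coefficients. The m-th Frobenius then maps roots of [Q k0] to roots, so
   the orbit of [u k0] is finite. *)
pose m := (\prod_(i < size (Q k0)) n i)%N.
have m_gt0 : (0 < m)%N by apply: prodn_gt0 => i; have [] := nP i.
have fix_mul (F : fieldType) (z : F) a b : z ^+ (p ^ a) = z -> z ^+ (p ^ (a * b)) = z.
  move=> za; elim: b => [|b IHb]; first by rewrite muln0 expr1.
  by rewrite mulnS expnD exprM za IHb.
have Q_fix : map_poly (frobenius hE m) (Q k0) = Q k0.
  apply/polyP => i; rewrite coef_map; case: (ltnP i (size (Q k0))) => [lti|lei]; last first.
    by rewrite nth_default //= rmorph0.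
  rewrite /= /frobenius /m (bigD1 (Ordinal lti)) //=.
  by apply: fix_mul; have [] := nP i.
have [[Q0 Qu] _ _] := QP k0.
have root_orbit t : (map_poly iota (Q k0)).[u k0 ^+ (p ^ (m * t))] = 0.
  elim: t => [|t IHt]; first by rewrite muln0 expr1.
  rewrite mulnSr expnD exprM -{1}Q_fix frob_map IHt expr0n gtn_eqF //.
  by rewrite expn_gt0 prime_gt0.
have [t [t' [ltt tt']]] : exists t t', (t < t')%N /\
    u k0 ^+ (p ^ (m * t)) = u k0 ^+ (p ^ (m * t')).
  apply: contrapT => inj.
  have := @max_poly_roots _ (map_poly iota (Q k0))
    (mkseq (fun t => u k0 ^+ (p ^ (m * t))) (size (Q k0))).
  rewrite map_poly_eq0 Q0 size_map_poly size_mkseq ltnn => /(_ isT) H.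
  suff : false by []; apply: H.
    by apply/allP => _ /mapP[t _ ->]; apply/rootP.
  apply: mkseq_uniq => t t' /eqP; have [ltt|ltt|//] := ltngtP t t' => /eqP tt'.
    by case: inj; exists t, t'.
  by case: inj; exists t', t.
exists (m * (t' - t))%N; first by rewrite muln_gt0 m_gt0 subn_gt0.
have [_ ->] := uP k0; rewrite -!exprM mulnC exprM; congr (_ ^+ _).
apply: (fmorph_inj (frobenius hK (m * t))); rewrite /= /frobenius tt' -exprM -expnD.
by rewrite -mulnDr subnK // ltnW.
Qed.
Lemma divisible_adjoin_field : divisible_algebraic adjoin_field.
Proof.
have [y_tr|] := pselect (forall P, ev P = 0 -> P = 0); first exact: divisible_adjoin_transcendental.
by move=> /existsNP[P /not_implyP[Py /eqP P0]]; apply: divisible_adjoin_algebraic P0 Py.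
Qed.

End Adjoin.

(** Adjoin the elements of [X] one at a time to the prime field, described as the solutions of x^p =
    x. *)
Lemma finitely_generated_subfield (X : seq K) : exists A : set K,
  [/\ is_subfield A, divisible_algebraic A & forall x, x \in X -> A x].
Proof.
elim: X => [|y X [A [subA divA XA]]].
  exists (fun x => x ^+ p = x); split=> //; last by move=> x xp _; exists 1%N; rewrite ?expn1.
  split=> [|x y xp yp|x y xp yp|x xp]; first exact: expr1n.
  - by rewrite -[in RHS]xp -[in RHS]yp -!(pFrobenius_autE hK) rmorphB.
  - by rewrite exprMn xp yp.
  - by rewrite exprVn xp.
have [E [iota AE]] := subfield_embedding subA.
have E_div : divisible_algebraic (in_base iota).
  move=> x /AE Ax x_div; apply: divA => // k.
  by have [u /AE Au xu] := x_div k; exists u.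
exists (adjoin_field iota y); split; first exact: adjoin_field_subfield.
  exact: divisible_adjoin_field.
move=> x; rewrite inE => /predU1P[->|/XA/AE[e ->]]; first exact: adjoin_field_id.
exact: adjoin_field_base.
Qed.
(** In a subfield finitely generated over the prime field and containing the [X i], take for each i
    the last root before the first level at which none exists. Such a level exists, as otherwise
    [X i] would be fixed by a power of Frobenius. *)
Theorem frobenius_roots (N : nat) (X : 'I_N -> K) :
  (forall i n, (0 < n)%N -> X i ^+ (p ^ n) <> X i) ->
  exists (F : fieldType) (iota : {rmorphism F -> K}) (u : 'I_N -> F) (k : 'I_N -> nat),
    forall i, X i = iota (u i) ^+ (p ^ k i) /\ ~ exists y, u i = y ^+ p.
Proof.
move=> X_inf; have [A [subA divA XA]] := finitely_generated_subfield (codom X).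
have [F [iota AF]] := subfield_embedding subA.
have /fin_all_exists[uk ukP] i : exists uk : F * nat,
    X i = iota uk.1 ^+ (p ^ uk.2) /\ ~ exists y, uk.1 = y ^+ p.
  have AX : A (X i) by apply: XA; apply: codom_f.
  pose bad k := ~~ `[< exists2 u, A u & X i = u ^+ (p ^ k) >].
  have ex_bad : exists k, bad k.
    apply: contrapT => no_bad; have [k|n n0] := divA (X i) AX; last exact: X_inf.
    by apply: contrapT => kX; apply: no_bad; exists k; apply/asboolPn.
  case: (ex_minnP ex_bad) => -[|k] /asboolPn bad_k k_min.
    by case: bad_k; exists (X i); rewrite ?expr1.
  have /negPn/asboolP[_ /AF[u ->] Xu] : ~~ bad k by apply/negP => /k_min; rewrite ltnn.
  exists (u, k); split=> // -[y]; rewrite [LHS]/= => uy; apply: bad_k.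
  exists (iota y); first by apply/AF; exists y.
  by rewrite Xu uy rmorphXn -exprM expnS.
by exists F, iota, (fun i => (uk i).1), (fun i => (uk i).2).
Qed.

End FinitelyGenerated.

(** * Linear independence in the tensor product with the rationals *)

Section RationalTensor.
Variable A : zmodType.

Lemma numq_denq_dvd (q : rat) (M : nat) : (`|denq q| %| M)%N -> M%:R * q = (numq (M%:R * q))%:~R.
Proof.
move=> /dvdnP[m ->]; rewrite natrM -mulrA.
have -> : `|denq q|%:R * q = (numq q)%:~R.
  rewrite natr_absz ger0_norm // -[X in _ * X]divq_num_den mulrC divfK //.
  by rewrite intr_eq0 denq_neq0.
by rewrite -[m%:R]/(m%:Z%:~R) -intrM numq_int.
Qed.

(* The image of a formal sum under the map [a (x) q |-> (M q) a], which is meaningful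
   once [M] is a common denominator; [numq] then merely reads the integer [M q]. *)
Definition cleared_sum (M : nat) (s : seq (A * rat)) : A :=
  \sum_(aq <- s) aq.1 *~ numq (M%:R * aq.2).

(** Only additivity in the rational factor requires denominators to be cleared; [N] collects those
    met along the derivation of the congruence. *)
Lemma cleared_sum_tensor_eq (s t : seq (A * rat^o)) : tensor_eq s t ->
  exists2 N, (0 < N)%N & forall M, (N %| M)%N -> cleared_sum M s = cleared_sum M t.
Proof.
elim=> {s t} [s|s t _ [N N0 st]|s t u _ [N N0 st] _ [N' N'0 tu]
  |s s' t t' _ [N N0 ss'] _ [N' N'0 tt']|s t st|b|a|a a' b|a b b'].
- by exists 1%N.
- by exists N => // M /st.
- exists (N * N')%N => [|M NM]; first by rewrite muln_gt0 N0.
  rewrite (st M) ?(tu M) //; apply: dvdn_trans NM; first exact: dvdn_mull.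
  exact: dvdn_mulr.
- exists (N * N')%N => [|M NM]; first by rewrite muln_gt0 N0.
  rewrite /cleared_sum !big_cat; congr (_ + _).
    by apply: ss'; apply: dvdn_trans NM; apply: dvdn_mulr.
  by apply: tt'; apply: dvdn_trans NM; apply: dvdn_mull.
- by exists 1%N => // M _; apply: perm_big.
- by exists 1%N => // M _; rewrite /cleared_sum big_seq1 big_nil mul0rz.
- by exists 1%N => // M _; rewrite /cleared_sum big_seq1 big_nil /= mulr0 mulr0z.
- by exists 1%N => // M _; rewrite /cleared_sum big_seq1 big_cons big_seq1 mulrzDl.
exists (`|denq b| * `|denq b'|)%N => [|M bM].
  by rewrite muln_gt0 !absz_gt0 !denq_neq0.
rewrite /cleared_sum big_seq1 big_cons big_seq1 -mulrzDr /=; congr (_ *~ _).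
apply: (intr_inj (R := rat)); rewrite intrD mulrDr.
have Mb : M%:R * b = (numq (M%:R * b))%:~R.
  by apply: numq_denq_dvd; apply: dvdn_trans bM; apply: dvdn_mulr.
have Mb' : M%:R * b' = (numq (M%:R * b'))%:~R.
  by apply: numq_denq_dvd; apply: dvdn_trans bM; apply: dvdn_mull.
by rewrite -Mb -Mb' Mb Mb' -intrD numq_int.
Qed.

(** If n > r, the tensors of the [e i] with 1 are dependent over the rationals, and [cleared_sum]
    turns the relation into a nontrivial integral one. *)
Lemma free_le_dim_tensor (n r : nat) (e : 'I_n -> A) :
  (forall c : 'I_n -> int, \sum_i e i *~ c i = 0 -> forall i, c i = 0) ->
  has_dim (tensor A rat^o) r -> (n <= r)%N.
Proof.
move=> e_free [b b_basis]; rewrite leqNgt; apply/negP => ltrn.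
have /fin_all_exists[g gE] i : exists g : {ffun 'I_r -> rat},
    pure_tensor (e i) (1 : rat^o) = \sum_j g j *: b j.
  by have [g [gE _]] := b_basis (pure_tensor (e i) 1); exists g.
have [|q [[i qi] qg]] := @linear_dependence rat _ _ (fun i j => g i j).
  by rewrite !card_ord.
have : tensor_class [seq (e i, q i : rat^o) | i <- index_enum 'I_n] = tensor_class [::].
  rewrite tensor_class_sum big_map.
  transitivity (\sum_i \sum_j (q i * g i j) *: b j).
    apply: eq_bigr => k _; under [RHS]eq_bigr do rewrite -scalerA.
    by rewrite -scaler_sumr -gE scale_pure_tensor /= [_ *: _]mulr1.
  rewrite exchange_big big1 // => j _.
  by rewrite -scaler_suml qg scale0r.
move/tensor_classP/cleared_sum_tensor_eq => [N N0 /(_ N (dvdnn N))].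
rewrite /cleared_sum big_map big_nil => /e_free/(_ i)/eqP.
rewrite numq_eq0 mulf_eq0 (negPf qi) orbF pnatr_eq0 => /eqP N_0.
by rewrite N_0 in N0.
Qed.

End RationalTensor.

(** * Solutions in a subgroup *)

Local Open Scope classical_set_scope.
Local Open Scope card_scope.

Lemma injection_of_not_card_le (T : Type) (A : set T) (M : nat) : ~ (A #<= `I_M) ->
  exists g : 'I_M.+1 -> T, injective g /\ forall i, A (g i).
Proof.
move=> AM.
have /card_leP[f] : `I_M.+1 #<= A.
  have [[n An]|/infiniteP natA] := pselect (finite_set A).
    rewrite (card_le_eqr An) card_le_II ltnNge; apply/negP => lenM; apply: AM.
    by rewrite (card_le_eql An) card_le_II.
  exact: card_le_trans (subset_card_le (@subsetT _ _)) natA.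
have ord_in (i : 'I_M.+1) : (i : nat) \in `I_M.+1 by apply/mem_set/ltn_ord.
exists (fun i => val (f (SigSub (ord_in i)))); split=> [i j /val_inj fij|i]; last first.
  exact/set_mem/valP.
by have := @inj _ _ _ f _ _ (in_setT _) (in_setT _) fij => /(congr1 val) /= /val_inj.
Qed.

Section Subgroup.
Variables (K : fieldType) (G : subgroup K).

Lemma subgroupX u n : subgroup_set G u -> subgroup_set G (u ^+ n).
Proof.
move=> Gu; elim: n => [|n IHn]; first by rewrite expr0; apply: subgroup1.
by rewrite exprS; apply: subgroupM.
Qed.

Lemma pair_expr (a b : K) n : (a, b) ^+ n = (a ^+ n, b ^+ n).
Proof. by elim: n => [|n IHn]; rewrite ?expr0 // !exprS IHn. Qed.

Lemma pair_invr (a b : K) : a != 0 -> b != 0 -> (a, b)^-1 = (a^-1, b^-1).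
Proof.
move=> a0 b0; have ab : (a, b) * (a^-1, b^-1) = 1.
  by rewrite -[LHS]/(a * a^-1, b * b^-1) !divff.
have u_ab : (a, b) \is a GRing.unit by apply/andP; rewrite !unitfE.
by rewrite -[LHS]mulr1 -ab mulKr.
Qed.

Lemma subgroup_zmod_mulz (x : subgroup_zmod G) (c : int) :
  (val (x *~ c)).1 = (val x).1 ^ c /\ (val (x *~ c)).2 = (val x).2 ^ c.
Proof.
have [x1 x2] := subgroup_neq0 (set_mem (valP x)).
have mulrn n : (val (x *+ n)).1 = (val x).1 ^+ n /\ (val (x *+ n)).2 = (val x).2 ^+ n.
  elim: n => [//|n [IH1 IH2]]; by rewrite mulrS !exprS -IH1 -IH2.
case: c => n; first exact: mulrn.
rewrite NegzE mulrNz -!exprnN; have [<- <-] := mulrn n.+1.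
have := set_mem (valP (x *+ n.+1)) => /subgroup_neq0[].
have -> : val (x *- n.+1) = (val (x *+ n.+1))^-1 by [].
case: (val (x *+ n.+1)) => c d /= c0 d0.
by rewrite pair_invr.
Qed.

Lemma subgroup_zmod_sum (I : Type) (r : seq I) (x : I -> subgroup_zmod G) (c : I -> int) :
  (val (\sum_(i <- r) x i *~ c i)).1 = \prod_(i <- r) (val (x i)).1 ^ c i /\
  (val (\sum_(i <- r) x i *~ c i)).2 = \prod_(i <- r) (val (x i)).2 ^ c i.
Proof.
elim: r => [|i r [IH1 IH2]]; first by rewrite !big_nil.
have [E1 E2] := subgroup_zmod_mulz (x i) (c i).
by rewrite !big_cons -IH1 -IH2 -E1 -E2.
Qed.

End Subgroup.

Section Solutions.
Variables (p : nat) (hp : prime p) (K : fieldType) (hK : p \in [pchar K]).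
Variables (G : subgroup K) (a b : K) (ha : a != 0) (hb : b != 0).
Hypothesis ab_tors :
  ~ (exists n : nat, [/\ (1 <= n)%N, gcdn n p = 1%N & subgroup_set G ((a, b) ^+ n)]).
Variables (N : nat) (g : 'I_N -> K * K).
Hypothesis gG : forall i, subgroup_set G (g i).
Hypothesis g_sol : forall i, a * (g i).1 + b * (g i).2 = 1.
Hypothesis g_inj : injective g.

Let X i := a * (g i).1.
Let Y i := b * (g i).2.

Let Y_frobenius i j n : X j = X i ^+ (p ^ n) -> Y j = Y i ^+ (p ^ n).
Proof.
have YE l : Y l = 1 - X l by rewrite -(g_sol l) [a * _ + _]addrC addrK.
by move=> XX; rewrite !YE XX -!/(frobenius hK n _) rmorphB rmorph1.
Qed.

(** With q = p^n, both coordinates of the relation give (a, b)^(q-1) = g_j / g_i^q in [G], and q - 1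
    is prime to p. The case i = j is included. *)
Lemma solutions_not_frobenius_conjugate i j n : (0 < n)%N -> X j <> X i ^+ (p ^ n).
Proof.
move=> n0 XX; have YY := Y_frobenius XX.
apply: ab_tors; exists (p ^ n).-1; set q := (p ^ n)%N.
have q_gt1 : (1 < q)%N by rewrite -(exp1n n) ltn_exp2r ?prime_gt1.
have qE : q = q.-1.+1 by rewrite prednK // ltnW.
split; first by rewrite -ltnS -qE.
  apply/eqP; rewrite -/(coprime _ _) coprime_sym prime_coprime //.
  have pq : (p %| q.-1 + 1)%N by rewrite addn1 -qE dvdn_exp.
  by apply/negP => pq1; move: pq; rewrite dvdn_addr // dvdn1 => /eqP p1; have := hp; rewrite p1.
have -> : (a, b) ^+ q.-1 = g j * (g i ^+ q)^-1.
  have [gi1 gi2] := subgroup_neq0 (gG i); have [gj1 gj2] := subgroup_neq0 (gG j).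
  move: XX YY; rewrite /X /Y -/q; case: (g i) gi1 gi2 (g j) gj1 gj2 => c d /= c0 d0 [e f] /= e0 f0.
  rewrite !pair_expr pair_invr ?expf_neq0 // => XX YY.
  congr (_, _); [move: XX|move: YY]; rewrite exprMn {1}qE exprS -mulrA => /mulfI->//;
    by rewrite mulfK ?expf_neq0.
by apply: subgroupM => //; apply: subgroupV; apply: subgroupX.
Qed.

Lemma solutions_bound (r : nat) : has_dim (tensor (subgroup_zmod G) rat^o) r ->
  (N <= 4 ^ r.+1)%N.
Proof.
move=> dim_r.
have X_inf i n : (0 < n)%N -> X i ^+ (p ^ n) <> X i.
  by move=> n0 /esym; apply: solutions_not_frobenius_conjugate.
have [F [iota [u [k uk]]]] := frobenius_roots hK X_inf.
have hF : p \in [pchar F] by rewrite -(fmorph_pchar iota).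
have X_inj i j : X i = X j -> i = j.
  move=> Xij; have := @Y_frobenius j i 0; rewrite !expr1 => /(_ Xij) Yij.
  apply: g_inj; move: Xij Yij; rewrite /X /Y => /(mulfI ha) + /(mulfI hb).
  by case: (g i) (g j) => [? ?] [? ?] /= -> ->.
have u_inj : injective u.
  suff H i j : u i = u j -> (k i <= k j)%N -> i = j.
    move=> i j uij; case: (leqP (k i) (k j)) => [/H->//|/ltnW/H H'].
    exact/esym/H'.
  move=> uij kij; have Xij : X j = X i ^+ (p ^ (k j - k i)).
    by rewrite (uk j).1 (uk i).1 -uij -exprM -expnD subnKC.
  case: (posnP (k j - k i)) Xij => [->|kk]; first by rewrite expr1 => /X_inj.
  by move/solutions_not_frobenius_conjugate.
have [D [DM Dp Du]] := separating_derivation hF (fun i => (uk i).2).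
pose v i := 1 - u i.
have uv1 i : u i + v i = 1 by rewrite addrC subrK.
have [s [J [Ns J_free]]] := solutions_bound_rank hF DM Dp uv1 Du u_inj.
have Xu i : X i = iota (u i) ^+ (p ^ k i) := (uk i).1.
have Yv i : Y i = iota (v i) ^+ (p ^ k i).
  rewrite rmorphB rmorph1 -/(frobenius hK (k i) _) rmorphB rmorph1 /= /frobenius -Xu.
  by rewrite -(g_sol i) [a * _ + _]addrC addrK.
have XY_free (n : 'I_s -> int) : \prod_j X (J j) ^ n j = 1 -> \prod_j Y (J j) ^ n j = 1 ->
    forall j, n j = 0.
  move=> Xn Yn j.
  (* A relation between the [X] or [Y] is one between the [u] or [v], with each exponent multiplied
     by its own power of p. *)
  have root1 (Z : 'I_N -> K) (z : 'I_N -> F) : (forall i, Z i = iota (z i) ^+ (p ^ k i)) ->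
      \prod_j Z (J j) ^ n j = 1 -> \prod_j z (J j) ^ ((p ^ k (J j))%:Z * n j) = 1.
    move=> Zz Zn; apply: (fmorph_inj iota); rewrite rmorph1 -[RHS]Zn rmorph_prod.
    by apply: eq_bigr => l _; rewrite Zz fmorphXz -exprz_exp.
  have /eqP := J_free _ (root1 X u Xu Xn) (root1 Y v Yv Yn) j.
  have pk0 : (p ^ k (J j))%:Z != 0 by rewrite eqz_nat -lt0n expn_gt0 prime_gt0.
  by rewrite mulf_eq0 (negPf pk0) => /eqP.
apply: leq_trans Ns _; rewrite leq_exp2l //.
case: s J {J_free} XY_free => [//|s] J XY_free; rewrite ltnS.
pose w i : subgroup_zmod G := exist _ (g i) (mem_set (gG i)).
apply: (@free_le_dim_tensor _ _ _ (fun j => w (J (lift ord0 j)) - w (J ord0))) dim_r => c c0 j.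
(* The exponent at the reference solution makes the total zero. A common factor a or b then
   contributes nothing, so a relation in [G] becomes one between the [X] and the [Y]. *)
pose n i := if unlift ord0 i is Some l then c l else - \sum_l c l.
have -> : c j = n (lift ord0 j) by rewrite /n liftK.
have {}c0 : \sum_i w (J i) *~ n i = 0.
  rewrite big_ord_recl {1}/n unlift_none mulrNz mulrz_sumr addrC -[RHS]c0 -sumrB.
  by apply: eq_bigr => l _; rewrite /n liftK mulrzBl.
have n0 : \sum_i n i = 0.
  rewrite big_ord_recl {1}/n unlift_none addrC; apply/eqP; rewrite subr_eq0; apply/eqP.
  by apply: eq_bigr => l _; rewrite /n liftK.
have scale (d : K) (Z : 'I_N -> K) : d != 0 -> \prod_i Z (J i) ^ n i = 1 ->
    \prod_i (d * Z (J i)) ^ n i = 1.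
  move=> d0 Zn; under eq_bigr do rewrite expfzMl.
  rewrite big_split /= Zn mulr1 -[RHS](expr0z d) -n0; apply/esym.
  by apply: (big_morph (exprz d)) => // x y; apply: expfzDr.
have [E1 E2] := subgroup_zmod_sum (index_enum _) (w \o J) n.
have [P1 P2] : \prod_i (g (J i)).1 ^ n i = 1 /\ \prod_i (g (J i)).2 ^ n i = 1.
  by rewrite -[LHS]E1 -[X in _ /\ X = _]E2 c0.
apply: (XY_free n); first exact: (scale a (fun i => (g i).1)).
exact: (scale b (fun i => (g i).2)).
Qed.
End Solutions.

Theorem theorem1 (p : nat) (hp : prime p)
    (K : fieldType) (hK : p \in [pchar K])
    (G : subgroup K) (r : nat) (hr : has_dim (tensor (subgroup_zmod G) rat^o) r)
    (a b : K) (ha : a != 0) (hb : b != 0) :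
  ~ (exists n : nat, [/\ (1 <= n)%N, gcdn n p = 1%N & subgroup_set G ((a, b) ^+ n)]) ->
  [set u : K * K | subgroup_set G u /\ a * u.1 + b * u.2 = 1] #<= `I_(31 * 19 ^ r.+1).
Proof.
move=> ab_tors; apply: contrapT => /injection_of_not_card_le[g [g_inj gP]].
have := solutions_bound hp hK ha hb ab_tors (fun i => (gP i).1) (fun i => (gP i).2) g_inj hr.
(* The proved bound 4^(r+1) is already below 19^(r+1). *)
apply/negP; rewrite -ltnNge ltnS; apply: (@leq_trans (19 ^ r.+1)); first by rewrite leq_exp2r.
by rewrite leq_pmull.
Qed.
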